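(* The group $\mathrm{PL}(I^2,\partial I^2)$ is locally indicable, and therefore left-orderable.
   Context: $I^2=[0,1]^2$. $\mathrm{PL}(I^2,\partial I^2)$ is the group, under composition, of homeomorphisms $I^2\to I^2$ that are pointwise fixed on the boundary $\partial I^2$ and are linear on each simplex of some finite triangulation (subdivision) of $I^2$. A group is locally indicable if every nontrivial finitely generated subgroup admits a surjection onto $\mathbb Z$; it is left-orderable if it admits a strict total order invariant under left multiplication. *)

(* Defs.v *)
From Stdlib Require Import Reals List.
Import ListNotations.
Open Scope R_scope.

Definition pt := (R * R)%type.
Definition map2 := pt -> pt.

Definition in_I2 (p : pt) : Prop :=
  0 <= fst p <= 1 /\ 0 <= snd p <= 1.
Definition in_bdI2 (p : pt) : Prop :=
  in_I2 p /\ (fst p = 0 \/ fst p = 1 \/ snd p = 0 \/ snd p = 1).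

Fixpoint wsum (w : list R) (l : list pt) : pt :=
  match w, l with
  | a :: w', v :: l' =>
      let s := wsum w' l' in (a * fst v + fst s, a * snd v + snd s)
  | _, _ => (0, 0)
  end.

Definition in_hull_sel (P : pt -> Prop) (l : list pt) (p : pt) : Prop :=
  exists w : list R,
    length w = length l /\
    Forall (fun a => 0 <= a) w /\
    fold_right Rplus 0 w = 1 /\
    Forall2 (fun a v => a <> 0 -> P v) w l /\
    p = wsum w l.

Definition in_hull (l : list pt) (p : pt) : Prop := in_hull_sel (fun _ => True) l p.

Definition tri := (pt * pt * pt)%type.
Definition verts (t : tri) : list pt :=
  let '(a, b, c) := t in [a; b; c].
Definition nondeg (t : tri) : Prop :=
  let '(a, b, c) := t in
  (fst b - fst a) * (snd c - snd a) - (snd b - snd a) * (fst c - fst a) <> 0.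
Definition in_tri (t : tri) (p : pt) : Prop := in_hull (verts t) p.

(** A finite triangulation of I^2: finitely many nondegenerate triangles whose
    union is I^2, and any two of which meet in the (possibly empty) common face
    spanned by their common vertices (geometric simplicial complex). *)
Definition triangulation_I2 (T : list tri) : Prop :=
  Forall nondeg T /\
  (forall p, in_I2 p <-> exists t, In t T /\ in_tri t p) /\
  (forall t1 t2, In t1 T -> In t2 T -> forall p,
      (in_tri t1 p /\ in_tri t2 p) <->
      in_hull_sel (fun v => In v (verts t2)) (verts t1) p).

Definition affine_on (S : pt -> Prop) (f : map2) : Prop :=
  exists a b c d e g : R, forall p, S p ->
    f p = (a * fst p + b * snd p + e, c * fst p + d * snd p + g).

Definition cont_on_I2 (f : map2) : Prop :=
  forall p, in_I2 p -> forall eps, 0 < eps -> exists delta, 0 < delta /\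
    forall q, in_I2 q -> Rabs (fst q - fst p) < delta -> Rabs (snd q - snd p) < delta ->
      Rabs (fst (f q) - fst (f p)) < eps /\ Rabs (snd (f q) - snd (f p)) < eps.

Definition homeo_I2 (f : map2) : Prop :=
  (forall p, in_I2 p -> in_I2 (f p)) /\
  exists g : map2,
    (forall p, in_I2 p -> in_I2 (g p)) /\
    (forall p, in_I2 p -> g (f p) = p) /\
    (forall p, in_I2 p -> f (g p) = p) /\
    cont_on_I2 f /\ cont_on_I2 g.

(** Elements of PL(I^2, ∂I^2).  A homeomorphism of I^2 is encoded by its
    canonical extension to R^2 which is the identity outside I^2, so that two
    elements are equal iff they agree on I^2. *)
Definition PL_I2 (f : map2) : Prop :=
  homeo_I2 f /\
  (forall p, in_bdI2 p -> f p = p) /\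
  (exists T, triangulation_I2 T /\ forall t, In t T -> affine_on (in_tri t) f) /\
  (forall p, ~ in_I2 p -> f p = p).

Definition comp (f g : map2) : map2 := fun p => f (g p).
Definition idm : map2 := fun p => p.

Inductive gen (l : list map2) : map2 -> Prop :=
| gen_one : gen l idm
| gen_mul : forall s h, In s l -> gen l h -> gen l (comp s h)
| gen_mulinv : forall s t h, In s l ->
    (forall p, t (s p) = p) -> (forall p, s (t p) = p) ->
    gen l h -> gen l (comp t h).

Definition locally_indicable_PL : Prop :=
  forall l : list map2, Forall PL_I2 l ->
    (exists h, gen l h /\ h <> idm) ->
    exists phi : map2 -> Z,
      (forall h1 h2, gen l h1 -> gen l h2 ->
          phi (comp h1 h2) = (phi h1 + phi h2)%Z) /\
      (forall z : Z, exists h, gen l h /\ phi h = z).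

Definition left_orderable_PL : Prop :=
  exists lt : map2 -> map2 -> Prop,
    (forall f, PL_I2 f -> ~ lt f f) /\
    (forall f g h, PL_I2 f -> PL_I2 g -> PL_I2 h -> lt f g -> lt g h -> lt f h) /\
    (forall f g, PL_I2 f -> PL_I2 g -> f <> g -> lt f g \/ lt g f) /\
    (forall f g h, PL_I2 f -> PL_I2 g -> PL_I2 h -> lt g h -> lt (comp f g) (comp f h)).

(* Main.v *)
(** Extend the maps by the identity to homeomorphisms of the plane.  Given
    finitely many of them, not all trivial, let [C] be the infimum of the
    abscissas of moved points.  On a thin strip [C < x < e] the relevant lines do
    not cross, so the lower boundary of the set of moved points is a segment of
    one line [y = m x + k].  All the maps are the identity below this segment, and
    each is a single linear map just above it, so it acts there as
    [(x, t) |-> (x + a t, b t)], where [t] is the height above the line.  Here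
    [b > 0], because the region below is fixed and the map is injective.
    Thus germs at a point of the segment give a nontrivial homomorphism to the
    group of pairs [(a, b)]: [ln b], or else [a] when [b = 1] throughout, is a
    nonzero homomorphism to [R], and a finitely generated subgroup of [R] has a
    nonzero homomorphism to [Z].
    The same germ gives an explicit left order, with no need for the
    Burns-Hale theorem: [f] is positive when, for its own first segment, [b > 1],
    or [b = 1] and [a > 0]. *)

From Stdlib Require Import Reals List Lra Lia ZArith Classical ClassicalEpsilon
  FunctionalExtensionality.
Require Import Defs.
Import ListNotations.
Open Scope R_scope.

(** * Cellwise affine homeomorphisms of the plane *)

Definition sgneq (a b : R) : Prop := (0 < a <-> 0 < b) /\ (a < 0 <-> b < 0).

Definition functional := (R * R * R)%type.
Definition ev (u : functional) (z : pt) : R :=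
  fst (fst u) * fst z + snd (fst u) * snd z + snd u.
Definition ycoef (u : functional) : R := snd (fst u).

Definition same_signs (L : list functional) (z z' : pt) : Prop :=
  forall u, In u L -> sgneq (ev u z) (ev u z').

Definition affine := (functional * functional)%type.
Definition app (A : affine) (z : pt) : pt := (ev (fst A) z, ev (snd A) z).
Definition det (A : affine) : R :=
  fst (fst (fst A)) * snd (fst (snd A)) - snd (fst (fst A)) * fst (fst (snd A)).
Definition pullback (u : functional) (A : affine) : functional :=
  let '((a, b, e), (c, d, g)) := A in let '(p, q, r) := u in
  (p * a + q * c, p * b + q * d, p * e + q * g + r).
Definition affine_comp (A B : affine) : affine := (pullback (fst A) B, pullback (snd A) B).
Definition affine_id : affine := ((1, 0, 0), (0, 1, 0)).
Definition affine_inv (A : affine) : affine :=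
  let '((a, b, e), (c, d, g)) := A in let D := det A in
  ((d / D, - b / D, (b * g - d * e) / D), (- c / D, a / D, (c * e - a * g) / D)).

(** The coordinates of the displacement [app A z - z], written as functionals so that their zero
    lines can join an arrangement. *)
Definition xshift (A : affine) : functional :=
  let '((a, b, e), _) := A in (a - 1, b, e).
Definition yshift (A : affine) : functional :=
  let '(_, (c, d, g)) := A in (c, d - 1, g).

(** Piecewise affine in the weak sense: instead of a triangulation, an
    arrangement of finitely many lines; [f] is affine on each of its faces of
    any dimension. *)
Definition cellwise_affine (f : map2) : Prop :=
  exists (L : list functional) (As : list affine),
    (forall A, In A As -> det A <> 0) /\
    forall z, exists A, In A As /\ forall z', same_signs L z z' -> f z' = app A z'.

Definition continuous_R2 (f : map2) : Prop :=
  forall p eps, 0 < eps -> exists delta, 0 < delta /\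
    forall q, Rabs (fst q - fst p) < delta -> Rabs (snd q - snd p) < delta ->
      Rabs (fst (f q) - fst (f p)) < eps /\ Rabs (snd (f q) - snd (f p)) < eps.

Definition inverse_maps (f g : map2) : Prop :=
  (forall p, g (f p) = p) /\ (forall p, f (g p) = p).

(** All that the argument uses of an element of the group. This class is closed under composition
    and inversion without common refinements of triangulations. *)
Definition plane_PL (f : map2) : Prop :=
  cellwise_affine f /\ continuous_R2 f /\ (forall p, ~ in_I2 p -> f p = p) /\
  exists g, inverse_maps f g /\ continuous_R2 g.

Lemma sgneq_refl a : sgneq a a.
Proof. split; tauto. Qed.

Lemma sgneq_sym a b : sgneq a b -> sgneq b a.
Proof. intros [? ?]; split; tauto. Qed.

Lemma sgneq_trans a b c : sgneq a b -> sgneq b c -> sgneq a c.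
Proof. intros [? ?] [? ?]; split; tauto. Qed.

Lemma same_signs_refl L z : same_signs L z z.
Proof. intros u _; apply sgneq_refl. Qed.

Lemma same_signs_incl L L' z z' :
  incl L L' -> same_signs L' z z' -> same_signs L z z'.
Proof. intros HL H u Hu; apply H, HL, Hu. Qed.

Lemma ev_pullback u A z : ev (pullback u A) z = ev u (app A z).
Proof.
destruct u as [[p q] r], A as [[[a b] e] [[c d] g]]; unfold ev, app, ev; simpl; ring.
Qed.

Lemma app_comp A B z : app (affine_comp A B) z = app A (app B z).
Proof. unfold app at 1; simpl; now rewrite !ev_pullback. Qed.

Lemma app_id z : app affine_id z = z.
Proof. destruct z as [x y]; unfold app, ev; simpl; f_equal; ring. Qed.

Lemma det_comp A B : det (affine_comp A B) = det A * det B.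
Proof.
destruct A as [[[a b] e] [[c d] g]], B as [[[a' b'] e'] [[c' d'] g']].
unfold det; simpl; ring.
Qed.

Lemma app_inv_l A z : det A <> 0 -> app (affine_inv A) (app A z) = z.
Proof.
destruct A as [[[a b] e] [[c d] g]], z as [x y]; unfold app, ev, det; simpl; intros H.
unfold det; simpl; f_equal; field; exact H.
Qed.

Lemma app_inv_r A z : det A <> 0 -> app A (app (affine_inv A) z) = z.
Proof.
destruct A as [[[a b] e] [[c d] g]], z as [x y]; unfold app, ev, det; simpl; intros H.
unfold det; simpl; f_equal; field; exact H.
Qed.

Lemma det_inv A : det A <> 0 -> det (affine_inv A) <> 0.
Proof.
intros H; assert (E : det (affine_inv A) = / det A).
{ revert H; destruct A as [[[a b] e] [[c d] g]]; unfold det; simpl; intros H.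
  unfold det; simpl; field; exact H. }
rewrite E; now apply Rinv_neq_0_compat.
Qed.

Lemma ev_xshift A z : ev (xshift A) z = fst (app A z) - fst z.
Proof. destruct A as [[[a b] e] [[c d] g]]; unfold app, ev; simpl; ring. Qed.

Lemma ev_yshift A z : ev (yshift A) z = snd (app A z) - snd z.
Proof. destruct A as [[[a b] e] [[c d] g]]; unfold app, ev; simpl; ring. Qed.

(** * Closure under composition and inversion *)

(** The lines of [g] are refined by the pullbacks of the lines of [f] under every affine piece of
    [g]. Then [g] is a single piece [B] on a face, and the signs of the pullbacks under [B] keep the
    image inside one face of [f]. *)
Lemma cellwise_affine_comp f g :
  cellwise_affine f -> cellwise_affine g -> cellwise_affine (comp f g).
Proof.
intros [Lf [Af [Df Hf]]] [Lg [Ag [Dg Hg]]].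
exists (Lg ++ map (fun q => pullback (fst q) (snd q)) (list_prod Lf Ag)).
exists (map (fun q => affine_comp (fst q) (snd q)) (list_prod Af Ag)).
split.
- intros A HA; apply in_map_iff in HA as [[A1 A2] [<- HA]]; apply in_prod_iff in HA.
  simpl; rewrite det_comp; apply Rmult_integral_contrapositive_currified; [apply Df|apply Dg]; tauto.
- intros z; destruct (Hg z) as [B [HB EB]]; destruct (Hf (g z)) as [A [HA EA]].
  exists (affine_comp A B); split.
  + apply in_map_iff; exists (A, B); split; [reflexivity|]; apply in_prod_iff; tauto.
  + intros z' Hz'.
    assert (H1 : same_signs Lg z z').
    { eapply same_signs_incl; [|exact Hz']; apply incl_appl, incl_refl. }
    unfold comp; rewrite app_comp, <- (EB z' H1); apply EA.
    intros u Hu; rewrite (EB z' H1), (EB z (same_signs_refl _ _)), <- !ev_pullback.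
    apply Hz', in_or_app; right; apply in_map_iff; exists (u, B).
    split; [reflexivity|]; apply in_prod_iff; tauto.
Qed.

(** The lines of [f] are carried forward by each of its pieces. If [A] is the piece of [f] at [g z]
    and [z'] has the signs of [z], then the preimage of [z'] under [A] lies in the face of [g z],
    where [f] is [A]; so that preimage is [g z']. *)
Lemma cellwise_affine_inverse f g :
  inverse_maps f g -> cellwise_affine f -> cellwise_affine g.
Proof.
intros [gf fg] [L [As [HD H]]].
exists (map (fun q => pullback (fst q) (affine_inv (snd q))) (list_prod L As)).
exists (map affine_inv As); split.
- intros A HA; apply in_map_iff in HA as [B [<- HB]]; apply det_inv, HD, HB.
- intros z; destruct (H (g z)) as [A [HA E]].
  exists (affine_inv A); split; [now apply in_map|].
  intros z' Hz'; rewrite <- (app_inv_r A z' (HD A HA)) at 1.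
  assert (Ez : app (affine_inv A) z = g z).
  { rewrite <- (fg z) at 1; rewrite (E _ (same_signs_refl _ _)).
    apply app_inv_l, HD, HA. }
  rewrite <- E; [apply gf|].
  intros u Hu; rewrite <- Ez, <- !ev_pullback; apply Hz'.
  apply in_map_iff; exists (u, A); split; [reflexivity|]; apply in_prod_iff; tauto.
Qed.

Lemma continuous_R2_comp f g :
  continuous_R2 f -> continuous_R2 g -> continuous_R2 (comp f g).
Proof.
intros Hf Hg p eps He; destruct (Hf (g p) eps He) as [d [Hd Kf]].
destruct (Hg p d Hd) as [d' [Hd' Kg]]; exists d'; split; [exact Hd'|].
intros q H1 H2; destruct (Kg q H1 H2); now apply Kf.
Qed.

Lemma plane_PL_comp f g : plane_PL f -> plane_PL g -> plane_PL (comp f g).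
Proof.
intros [Cf [Kf [Of [f' [[f1 f2] Kf']]]]] [Cg [Kg [Og [g' [[g1 g2] Kg']]]]].
split; [now apply cellwise_affine_comp|split; [now apply continuous_R2_comp|split]].
- intros p Hp; unfold comp; now rewrite (Og p Hp), Of.
- exists (comp g' f'); split; [|now apply continuous_R2_comp].
  split; intros p; unfold comp; [now rewrite f1|now rewrite g2].
Qed.

Lemma plane_PL_inverse f g : plane_PL f -> inverse_maps f g -> plane_PL g.
Proof.
intros [Cf [Kf [Of [f' [[f1 f2] Kf']]]]] [g1 g2].
assert (E : f' = g) by (apply functional_extensionality; intros p; now rewrite <- (g2 p), f1, g2).
subst f'; split; [now apply (cellwise_affine_inverse f)|split; [exact Kf'|split]].
- intros p Hp; rewrite <- (Of p Hp) at 1; apply g1.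
- exists f; split; [split; assumption|exact Kf].
Qed.

(** * Triangulations *)

(** Barycentric coordinates by Cramer's rule; the first is one minus the other two. *)
Definition barycentric (t : tri) : list functional :=
  let '(a, b, c) := t in
  let D := (fst b - fst a) * (snd c - snd a) - (snd b - snd a) * (fst c - fst a) in
  let lb := ((snd c - snd a) / D, - (fst c - fst a) / D,
             (snd a * fst c - fst a * snd c) / D) in
  let lc := (- (snd b - snd a) / D, (fst b - fst a) / D,
             (fst a * snd b - snd a * fst b) / D) in
  let '(p, q, r) := lb in let '(p', q', r') := lc in
  [(- p - p', - q - q', 1 - r - r'); lb; lc].

Lemma in_tri_barycentric t p :
  nondeg t -> (in_tri t p <-> forall u, In u (barycentric t) -> 0 <= ev u p).
Proof.
destruct t as [[[ax ay] [bx by_]] [cx cy]], p as [x y].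
unfold nondeg, in_tri, in_hull, in_hull_sel; simpl; intros HD.
set (D := _ - _) in HD |- *.
split.
- intros [w [Hl [Hp [Hs [_ E]]]]].
  destruct w as [|w0 [|w1 [|w2 [|]]]]; try discriminate Hl.
  simpl in Hs, E; injection E as Ex Ey.
  inversion_clear Hp as [|? ? P0 H1]; inversion_clear H1 as [|? ? P1 H2].
  inversion_clear H2 as [|? ? P2 _].
  assert (E0 : w0 = 1 - w1 - w2) by lra.
  intros u [<-|[<-|[<-|[]]]]; unfold ev; simpl;
    [replace (_ + _) with w0|replace (_ + _) with w1|replace (_ + _) with w2];
    try assumption; rewrite Ex, Ey, E0; unfold D in *; field; exact HD.
- intros H.
  assert (H0 := H _ (or_introl eq_refl)).
  assert (H1 := H _ (or_intror (or_introl eq_refl))).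
  assert (H2 := H _ (or_intror (or_intror (or_introl eq_refl)))).
  unfold ev in H0, H1, H2; simpl in H0, H1, H2; clear H.
  match type of H0 with 0 <= ?e => set (e0 := e) in * end.
  match type of H1 with 0 <= ?e => set (e1 := e) in * end.
  match type of H2 with 0 <= ?e => set (e2 := e) in * end.
  exists [e0; e1; e2]; split; [reflexivity|split; [|split; [|split]]].
  + repeat (apply Forall_cons; [assumption|]); apply Forall_nil.
  + simpl; unfold e0, e1, e2; ring.
  + repeat constructor.
  + simpl; unfold e0, e1, e2, D in *; f_equal; field; exact HD.
Qed.

(** At the centroid all barycentric coordinates equal 1/3, so a short move in any direction keeps
    them nonnegative. *)
Lemma centroid_in_interior t (w : pt) :
  nondeg t -> exists z eps, 0 < eps /\ in_tri t z /\
    in_tri t (fst z + eps * fst w, snd z + eps * snd w).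
Proof.
intros Ht; assert (Hb := in_tri_barycentric t).
destruct t as [[[ax ay] [bx by_]] [cx cy]], w as [v w].
set (z := ((ax + bx + cx) / 3, (ay + by_ + cy) / 3) : pt).
set (t := (((ax, ay), (bx, by_)), (cx, cy)) : tri) in *.
assert (E : forall u, In u (barycentric t) -> ev u z = 1 / 3).
{ unfold nondeg in Ht; simpl in Ht.
  intros u [<-|[<-|[<-|[]]]]; unfold ev; simpl; field; exact Ht. }
assert (Heps : forall L : list functional, (forall u, In u L -> ev u z = 1 / 3) ->
   exists eps, 0 < eps /\ forall e, 0 <= e <= eps ->
     forall u, In u L -> 0 <= ev u (fst z + e * v, snd z + e * w)).
{ induction L as [|u L IH]; intros HL.
  - exists 1; split; [lra|]; intros e He u [].
  - destruct IH as [eps [He IH]]; [intros; apply HL; now right|].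
    set (s := fst (fst u) * v + snd (fst u) * w).
    assert (P : 0 < 3 * (1 + Rabs s)) by (assert (H := Rabs_pos s); lra).
    (* [s] is the rate of change of [u] along the direction, so [e * s] stays at least -1/3 within
       this bound. *)
    exists (Rmin eps (/ (3 * (1 + Rabs s)))); split.
    { apply Rmin_glb_lt; [exact He|now apply Rinv_0_lt_compat]. }
    intros e [H0 He1] u' [<-|Hu'].
    + assert (H1 : e <= / (3 * (1 + Rabs s))) by (eapply Rle_trans; [exact He1|apply Rmin_r]).
      replace (ev u _) with (ev u z + e * s) by (unfold ev, s; simpl; ring).
      rewrite HL by (now left).
      apply (Rmult_le_compat_r (3 * (1 + Rabs s))) in H1; [|lra].
      rewrite Rinv_l in H1 by lra.
      assert (H2 := Rle_abs (- s)); rewrite Rabs_Ropp in H2; nra.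
    + apply IH; [|exact Hu']; split; [exact H0|].
      eapply Rle_trans; [exact He1|apply Rmin_l]. }
destruct (Heps _ E) as [eps [He K]]; exists z, eps; split; [exact He|split].
- apply Hb; [exact Ht|]; intros u Hu; rewrite E by exact Hu; lra.
- apply Hb; [exact Ht|]; intros u Hu; apply K; [lra|exact Hu].
Qed.

Lemma singular_direction A :
  det A = 0 -> exists w : pt, w <> (0, 0) /\
    forall z e, app A (fst z + e * fst w, snd z + e * snd w) = app A z.
Proof.
destruct A as [[[a b] p] [[c d] q]]; unfold det, app, ev; simpl; intros HD.
destruct (classic (a = 0 /\ b = 0)) as [[-> ->]|Hab].
- destruct (classic (c = 0 /\ d = 0)) as [[-> ->]|Hcd].
  + exists (1, 0); split; [intros H; injection H; lra|]; intros; simpl; f_equal; ring.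
  + exists (d, - c); split; [intros H; injection H; intros; apply Hcd; lra|]; intros; simpl; f_equal; ring.
- exists (b, - a); split; [intros H; injection H; intros; apply Hab; lra|].
  intros z e; simpl; f_equal; [ring|].
  replace (c * _ + _ + q) with (c * fst z + d * snd z + q - e * (a * d - b * c)) by ring.
  rewrite HD; ring.
Qed.

(** A singular linear part would collapse a segment inside the triangle, against injectivity. *)
Lemma affine_on_triangle t f :
  nondeg t -> (forall p q, in_tri t p -> in_tri t q -> f p = f q -> p = q) ->
  affine_on (in_tri t) f ->
  exists A, det A <> 0 /\ forall p, in_tri t p -> f p = app A p.
Proof.
intros Ht Hinj [a [b [c [d [e [g H]]]]]].
exists (((a, b, e), (c, d, g)) : affine).
assert (E : forall p, in_tri t p -> f p = app ((a, b, e), (c, d, g)) p).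
{ intros p Hp; rewrite (H p Hp); reflexivity. }
split; [|exact E].
intros HD; destruct (singular_direction _ HD) as [w [Hw K]].
destruct (centroid_in_interior t w Ht) as [z [eps [He [Hz Hz']]]].
assert (Ez := Hinj _ _ Hz' Hz).
rewrite (E _ Hz), (E _ Hz'), K in Ez; specialize (Ez eq_refl).
destruct w as [v w], z as [x y]; injection Ez as E1 E2; simpl in E1, E2.
apply Hw; f_equal; nra.
Qed.

(** * From the square to the plane *)

Definition square_sides : list functional :=
  [(1, 0, 0); (-1, 0, 1); (0, 1, 0); (0, -1, 1)].

Lemma in_I2_sides p : in_I2 p <-> forall u, In u square_sides -> 0 <= ev u p.
Proof.
destruct p as [x y]; unfold in_I2; simpl; split.
- intros H u [<-|[<-|[<-|[<-|[]]]]]; unfold ev; simpl; lra.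
- intros H; assert (H1 := H (1, 0, 0)); assert (H2 := H (-1, 0, 1)).
  assert (H3 := H (0, 1, 0)); assert (H4 := H (0, -1, 1)).
  unfold ev in *; simpl in *; intuition lra.
Qed.

Lemma sgneq_nonneg a b : sgneq a b -> 0 <= a -> 0 <= b.
Proof. intros [_ E] Ha; apply Rnot_lt_le; intros Hb; apply E in Hb; lra. Qed.

(** An interior point has a box inside the square, where continuity is given. A point of the
    boundary or outside is fixed; a point near it is either in the square or itself fixed. *)
Lemma continuous_extension f :
  cont_on_I2 f -> (forall p, in_bdI2 p -> f p = p) -> (forall p, ~ in_I2 p -> f p = p) ->
  continuous_R2 f.
Proof.
intros Hc Hb Ho p eps He.
assert (Hfix : f p = p -> (exists d, 0 < d /\ forall q, Rabs (fst q - fst p) < d ->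
    Rabs (snd q - snd p) < d -> in_I2 q -> Rabs (fst (f q) - fst (f p)) < eps /\
    Rabs (snd (f q) - snd (f p)) < eps) ->
  exists delta, 0 < delta /\
    forall q, Rabs (fst q - fst p) < delta -> Rabs (snd q - snd p) < delta ->
      Rabs (fst (f q) - fst (f p)) < eps /\ Rabs (snd (f q) - snd (f p)) < eps).
{ intros E [d [Hd K]]; exists (Rmin d eps); split; [now apply Rmin_glb_lt|].
  intros q H1 H2.
  assert (M1 := Rmin_l d eps); assert (M2 := Rmin_r d eps).
  destruct (classic (in_I2 q)) as [Hq|Hq]; [apply K; auto; lra|].
  rewrite E, (Ho q Hq); lra. }
destruct (classic (in_I2 p)) as [Hp|Hp].
- destruct (Hc p Hp eps He) as [d [Hd K]].
  destruct (classic (in_bdI2 p)) as [Hbd|Hbd].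
  + apply Hfix; [now apply Hb|]; exists d; split; [exact Hd|]; intros; now apply K.
  + destruct p as [x y]; unfold in_bdI2, in_I2 in Hp, Hbd; simpl in Hp, Hbd.
    assert (0 < x /\ x < 1 /\ 0 < y /\ y < 1) as [X0 [X1 [Y0 Y1]]].
    { assert (x <> 0 /\ x <> 1 /\ y <> 0 /\ y <> 1) by tauto; lra. }
    exists (Rmin d (Rmin (Rmin x (1 - x)) (Rmin y (1 - y)))); split.
    { repeat apply Rmin_glb_lt; lra. }
    intros q H1 H2; apply Rmin_Rgt in H1 as [H1 H1'], H2 as [H2 H2'].
    apply Rmin_Rgt in H1' as [H1' _], H2' as [_ H2'].
    apply Rmin_Rgt in H1', H2'.
    apply K; try assumption; destruct q as [x' y']; unfold in_I2; simpl in *.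
    apply Rgt_lt, Rabs_def2 in H1, H2.
    destruct H1' as [A1 A2], H2' as [B1 B2].
    apply Rgt_lt, Rabs_def2 in A1, A2, B1, B2; lra.
- apply Hfix; [now apply Ho|].
  assert (exists u, In u square_sides /\ ev u p < 0) as [u [Hu Np]].
  { apply NNPP; intros N; apply Hp, in_I2_sides; intros u Hu.
    apply Rnot_lt_le; intros L; apply N; now exists u. }
  (* A violated side inequality keeps a whole box around [p] outside the square. *)
  exists (- ev u p); split; [lra|]; intros q H1 H2 Hq; exfalso.
  assert (0 <= ev u q) by (now apply in_I2_sides).
  apply Rabs_def2 in H1, H2; revert Hu; destruct p, q; simpl in *.
  intros [<-|[<-|[<-|[<-|[]]]]]; unfold ev in *; simpl in *; lra.
Qed.

(** The arrangement consists of the side lines of all triangles and of the square. Triangles are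
    given by weak inequalities in these functionals, so a face that meets a triangle lies in it. *)
Lemma PL_I2_plane_PL f : PL_I2 f -> plane_PL f.
Proof.
intros [[HfI [g [HgI [gf [fg [Cf Cg]]]]]] [Hb [[T [[Tn [Tc _]] Ta]] Ho]]].
split; [|split; [now apply continuous_extension|split; [exact Ho|]]].
- assert (HA : forall T', incl T' T -> exists As,
    (forall A, In A As -> det A <> 0) /\
    forall t, In t T' -> exists A, In A As /\ forall p, in_tri t p -> f p = app A p).
  { induction T' as [|t T' IH]; intros HT.
    - exists []; split; intros ? [].
    - destruct IH as [As [H1 H2]]; [intros t' Ht'; apply HT; now right|].
      assert (HtT : In t T) by (apply HT; now left).
      destruct (affine_on_triangle t f) as [A [DA EA]].
      + now apply (proj1 (Forall_forall _ _) Tn).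
      + intros p q Hp Hq E; rewrite <- (gf p), <- (gf q), E; try reflexivity;
          apply Tc; now exists t.
      + now apply Ta.
      + exists (A :: As); split.
        * intros A' [<-|HA']; auto.
        * intros t' [<-|Ht']; [exists A; split; [now left|exact EA]|].
          destruct (H2 t' Ht') as [A' [HA' EA']]; exists A'; split; [now right|exact EA']. }
  destruct (HA T (incl_refl T)) as [As [HD HAs]].
  exists (square_sides ++ flat_map barycentric T), (affine_id :: As); split.
  + intros A [<-|HA']; [unfold det; simpl; lra|now apply HD].
  + intros z; destruct (classic (in_I2 z)) as [Hz|Hz].
    * apply Tc in Hz as [t [Ht Hz]].
      assert (Nt : nondeg t) by now apply (proj1 (Forall_forall _ _) Tn).
      destruct (HAs t Ht) as [A [HA' EA]]; exists A; split; [now right|].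
      intros z' Hs; apply EA, in_tri_barycentric; [exact Nt|]; intros u Hu.
      apply (sgneq_nonneg (ev u z)); [|now apply (in_tri_barycentric t)].
      apply Hs, in_or_app; right; apply in_flat_map; now exists t.
    * exists affine_id; split; [now left|]; intros z' Hs; rewrite app_id; apply Ho.
      intros Hz'; apply Hz, in_I2_sides; intros u Hu; apply (sgneq_nonneg (ev u z')).
      -- apply sgneq_sym, Hs, in_or_app; now left.
      -- now apply in_I2_sides.
(* The given inverse is arbitrary outside the square, so it is replaced by the identity there. *)
- set (g' := fun p => if excluded_middle_informative (in_I2 p) then g p else p).
  assert (Eg : forall p, in_I2 p -> g' p = g p).
  { intros p Hp; unfold g'; now destruct excluded_middle_informative. }
  assert (Eo : forall p, ~ in_I2 p -> g' p = p).
  { intros p Hp; unfold g'; now destruct excluded_middle_informative. }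
  exists g'; split; [split|].
  + intros p; destruct (classic (in_I2 p)) as [Hp|Hp].
    * rewrite Eg by auto; now apply gf.
    * rewrite (Ho p Hp); now apply Eo.
  + intros p; destruct (classic (in_I2 p)) as [Hp|Hp].
    * rewrite Eg by auto; now apply fg.
    * rewrite (Eo p Hp); now apply Ho.
  + apply continuous_extension; [|intros p Hp; rewrite Eg by apply Hp|exact Eo].
    * intros p Hp eps He; destruct (Cg p Hp eps He) as [d [Hd K]].
      exists d; split; [exact Hd|]; intros q Hq H1 H2; rewrite !Eg by assumption.
      now apply K.
    * rewrite <- (Hb p Hp) at 1; apply gf, Hp.
Qed.

(** * Arrangements of lines over a strip *)

(** Up to a factor, the difference of heights of the lines [u = 0] and
    [v = 0] over [x]. *)
Definition crossing (u v : functional) (x : R) : R :=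
  (fst (fst u) * ycoef v - fst (fst v) * ycoef u) * x + (snd u * ycoef v - snd v * ycoef u).

(** The zero case ranges over all [x]: an affine function that vanishes on an interval vanishes
    everywhere. *)
Definition constant_sign (C e : R) (w : R -> R) : Prop :=
  (forall x, C < x < e -> 0 < w x) \/ (forall x, C < x < e -> w x < 0) \/ (forall x, w x = 0).

Definition noncrossing (L : list functional) (C e : R) : Prop :=
  forall u v, In u L -> In v L -> constant_sign C e (crossing u v).

(** A nonconstant affine function has the single zero [- b / a]; the strip ends there if this lies
    to the right of [C], and at [C + 1] otherwise. *)
Lemma affine_constant_sign a b C :
  exists e, C < e /\ constant_sign C e (fun x => a * x + b).
Proof.
destruct (Rtotal_order a 0) as [Ha|[->|Ha]].
- destruct (Rle_or_lt (a * C + b) 0) as [H|H].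
  + exists (C + 1); split; [lra|]; right; left; intros x Hx; nra.
  + exists (- b / a); assert (E : a * (- b / a) = - b) by (field; lra).
    split; [nra|]; left; intros x Hx; nra.
- exists (C + 1); split; [lra|]; destruct (Rtotal_order b 0) as [Hb|[->|Hb]].
  + right; left; intros; lra.
  + right; right; intros; lra.
  + left; intros; lra.
- destruct (Rle_or_lt 0 (a * C + b)) as [H|H].
  + exists (C + 1); split; [lra|]; left; intros x Hx; nra.
  + exists (- b / a); assert (E : a * (- b / a) = - b) by (field; lra).
    split; [nra|]; right; left; intros x Hx; nra.
Qed.

Lemma constant_sign_shrink C e e' w :
  e' <= e -> constant_sign C e w -> constant_sign C e' w.
Proof.
intros He [H|[H|H]]; [left|right; left|right; right]; intros x; [intros Hx..|]; apply H; lra.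
Qed.

Lemma noncrossing_strip L C : exists e, C < e /\ noncrossing L C e.
Proof.
assert (K : forall P : list (functional * functional), exists e, C < e /\
  forall u v, In (u, v) P -> constant_sign C e (crossing u v)).
{ induction P as [|[u v] P [e [He IH]]]; [exists (C + 1); split; [lra|intros ? ? []]|].
  destruct (affine_constant_sign (fst (fst u) * ycoef v - fst (fst v) * ycoef u)
    (snd u * ycoef v - snd v * ycoef u) C) as [e' [He' H]].
  exists (Rmin e e'); split; [now apply Rmin_glb_lt|].
  intros u' v' [E|E].
  - injection E as <- <-; eapply constant_sign_shrink; [apply Rmin_r|exact H].
  - eapply constant_sign_shrink; [apply Rmin_l|now apply IH]. }
destruct (K (list_prod L L)) as [e [He H]]; exists e; split; [exact He|].
intros u v Hu Hv; apply H, in_prod_iff; tauto.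
Qed.

Lemma constant_sign_sgneq C e w x x' :
  constant_sign C e w -> C < x < e -> C < x' < e -> sgneq (w x) (w x').
Proof.
intros [H|[H|H]] Hx Hx'; assert (H1 := H x); assert (H2 := H x');
  try specialize (H1 Hx); try specialize (H2 Hx'); split; lra.
Qed.

(** Serves to choose a height between the lines that must lie below a point and those that must lie
    above it. The threshold is raised past the elements of [L] one at a time. *)
Lemma separate {X : Type} (h : X -> R) (P Q : X -> Prop) (L L' : list X) :
  (forall u v, In u L -> In v L' -> P u -> Q v -> h u < h v) ->
  exists s, (forall u, In u L -> P u -> h u < s) /\ (forall v, In v L' -> Q v -> s < h v).
Proof.
assert (above : forall a, (forall v, In v L' -> Q v -> a < h v) ->
  exists s, a < s /\ forall v, In v L' -> Q v -> s < h v).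
{ clear; intros a; induction L' as [|v L' IH]; intros H.
  - exists (a + 1); split; [lra|intros ? []].
  - destruct IH as [s [Hs K]]; [intros; apply H; auto; now right|].
    destruct (classic (Q v)) as [Hv|Hv].
    + assert (Hav := H v (or_introl eq_refl) Hv).
      exists (Rmin s ((a + h v) / 2)); split; [apply Rmin_glb_lt; lra|].
      assert (M1 := Rmin_l s ((a + h v) / 2)); assert (M2 := Rmin_r s ((a + h v) / 2)).
      intros v' [<-|Hv'] Q'; [lra|]; specialize (K v' Hv' Q'); lra.
    + exists s; split; [exact Hs|]; intros v' [<-|Hv'] Q'; [tauto|auto]. }
induction L as [|u L IH]; intros H.
- assert (exists a, forall v, In v L' -> a < h v) as [a Ha].
  { clear; induction L' as [|v L' [a IH]]; [exists 0; intros ? []|].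
    exists (Rmin a (h v - 1)); assert (M1 := Rmin_l a (h v - 1)); assert (M2 := Rmin_r a (h v - 1)).
    intros v' [<-|Hv']; [lra|]; specialize (IH v' Hv'); lra. }
  exists a; split; [intros ? []|auto].
- destruct IH as [s [H1 H2]]; [intros; apply H; auto; now right|].
  destruct (classic (P u)) as [Hu|Hu].
  + destruct (above (h u)) as [s' [H3 H4]]; [intros; apply H; auto; now left|].
    exists (Rmax s s'); assert (M1 := Rmax_l s s'); assert (M2 := Rmax_r s s'); split.
    * intros u' [<-|Hu'] Pu'; [lra|]; specialize (H1 u' Hu' Pu'); lra.
    * intros v Hv Qv; apply Rmax_lub_lt; auto.
  + exists s; split; [|exact H2]; intros u' [<-|Hu'] Pu'; [tauto|auto].
Qed.

Definition height (u : functional) (x : R) : R := - (fst (fst u) * x + snd u) / ycoef u.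

Lemma ev_height u x y : ycoef u <> 0 -> ev u (x, y) = ycoef u * (y - height u x).
Proof. intros H; unfold height, ev, ycoef in *; simpl; field; exact H. Qed.

Lemma crossing_height u v x : ycoef u <> 0 -> ycoef v <> 0 ->
  crossing u v x = ycoef u * ycoef v * (height v x - height u x).
Proof. intros Hu Hv; unfold height, crossing; field; tauto. Qed.

Lemma sgneq_mult_cancel c a b : c <> 0 -> sgneq (c * a) (c * b) -> sgneq a b.
Proof.
unfold sgneq; intros Hc H.
destruct (Rtotal_order a 0) as [Ha|[Ha|Ha]], (Rtotal_order b 0) as [Hb|[Hb|Hb]];
  try (split; lra); exfalso; destruct (Rdichotomy _ _ Hc) as [Hc'|Hc']; destruct H; nra.
Qed.

(** The vertical order of the lines of [L] does not change over a strip
    without crossings. *)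
Lemma transport L C e x x1 y :
  noncrossing L C e -> In (0, 1, 0) L -> C < x < e -> C < x1 < e ->
  exists y1, same_signs L (x, y) (x1, y1).
Proof.
intros HN HL Hx Hx1.
(* Vertical lines: the crossing of such a [u] with the horizontal axis [(0, 1, 0)] is the value of
   [u] itself. *)
assert (Hver : forall u y1, In u L -> ycoef u = 0 -> sgneq (ev u (x, y)) (ev u (x1, y1))).
{ intros u y1 Hu H0; assert (S := constant_sign_sgneq _ _ _ _ _ (HN _ _ Hu HL) Hx Hx1).
  assert (E : forall x y, ev u (x, y) = crossing u (0, 1, 0) x).
  { intros; unfold ev, crossing; fold (ycoef u); rewrite H0; unfold ycoef; simpl; ring. }
  now rewrite !E. }
destruct (classic (exists u, In u L /\ ycoef u <> 0 /\ ev u (x, y) = 0))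
  as [[u0 [Hu0 [N0 E0]]]|HA].
(* The point lies on the line [u0]; it is moved along that line. *)
- exists (height u0 x1); intros u Hu.
  assert (S := constant_sign_sgneq _ _ _ _ _ (HN u u0 Hu Hu0) Hx Hx1).
  apply (sgneq_mult_cancel (ycoef u0)); [exact N0|].
  replace (ycoef u0 * ev u (x, y)) with (crossing u u0 x + ycoef u * ev u0 (x, y))
    by (unfold crossing, ev, ycoef; simpl; ring).
  replace (ycoef u0 * ev u (x1, height u0 x1)) with (crossing u u0 x1)
    by (unfold crossing, ev, height, ycoef in *; simpl; field; exact N0).
  now rewrite E0, Rmult_0_r, Rplus_0_r.
(* The point lies on no nonvertical line; a height is chosen between the lines below it and those
   above it. *)
- destruct (separate (fun u => height u x1) (fun u => ycoef u <> 0 /\ height u x < y)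
    (fun u => ycoef u <> 0 /\ y < height u x) L L) as [y1 [H1 H2]].
  { intros u v Hu Hv [Nu Lu] [Nv Lv].
    assert (S := constant_sign_sgneq _ _ _ _ _ (HN u v Hu Hv) Hx Hx1).
    rewrite !crossing_height in S by assumption.
    apply sgneq_mult_cancel in S; [|now apply Rmult_integral_contrapositive_currified].
    destruct S; lra. }
  exists y1; intros u Hu; destruct (Req_dec (ycoef u) 0) as [Z|Z]; [now apply Hver|].
  apply (sgneq_mult_cancel (/ ycoef u)); [now apply Rinv_neq_0_compat|].
  rewrite !ev_height, <- !Rmult_assoc, Rinv_l, !Rmult_1_l by assumption.
  destruct (Rtotal_order (height u x) y) as [K|[K|K]].
  + specialize (H1 u Hu (conj Z K)); split; lra.
  + exfalso; apply HA; exists u; rewrite ev_height, K by assumption; repeat split; auto; ring.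
  + specialize (H2 u Hu (conj Z K)); split; lra.
Qed.

Lemma nonzero_signs_near L p :
  exists d, 0 < d /\ forall q, Rabs (fst q - fst p) < d -> Rabs (snd q - snd p) < d ->
    forall u, In u L -> ev u p <> 0 -> sgneq (ev u p) (ev u q).
Proof.
induction L as [|u L [d [Hd IH]]]; [exists 1; split; [lra|intros ? ? ? ? []]|].
destruct (Req_dec (ev u p) 0) as [Z|Z].
{ exists d; split; [exact Hd|]; intros q H1 H2 u' [<-|Hu'] N; [tauto|now apply IH]. }
(* A Lipschitz constant of [u] for the maximum norm, made positive by the summand 1. *)
set (c := 1 + Rabs (fst (fst u)) + Rabs (snd (fst u))).
assert (A1 := Rabs_pos (fst (fst u))); assert (A2 := Rabs_pos (snd (fst u))).
assert (Hc : 0 < c) by (unfold c; lra).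
assert (P := Rabs_pos_lt _ Z).
exists (Rmin d (Rabs (ev u p) / c)); split.
{ apply Rmin_glb_lt; [exact Hd|now apply Rdiv_lt_0_compat]. }
intros q H1 H2; apply Rmin_Rgt in H1 as [H1 H1'], H2 as [H2 H2'].
intros u' [<-|Hu'] N; [|now apply IH].
apply Rgt_lt in H1', H2'.
assert (E : c * (Rabs (ev u p) / c) = Rabs (ev u p)) by (field; lra).
set (h := Rabs (ev u p) / c) in *.
assert (B : Rabs (ev u q - ev u p) < Rabs (ev u p)).
{ replace (ev u q - ev u p) with
    (fst (fst u) * (fst q - fst p) + snd (fst u) * (snd q - snd p)) by (unfold ev; ring).
  eapply Rle_lt_trans; [apply Rabs_triang|]; rewrite !Rabs_mult, <- E.
  assert (B1 := Rabs_pos (fst q - fst p)); assert (B2 := Rabs_pos (snd q - snd p)).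
  unfold c; nra. }
revert B; unfold Rabs; repeat destruct Rcase_abs; intros B; split; lra.
Qed.

(** * The first segment and its germ *)

Definition above (m k x t : R) : pt := (x, m * x + k + t).

(** The abscissa [x'] varies too, since a shear moves points sideways and a composite evaluates its
    outer map at another abscissa. *)
Definition shear_at (m k x a b : R) (f : map2) : Prop :=
  exists r, 0 < r /\ forall x' t, Rabs (x' - x) < r -> 0 < t < r ->
    f (above m k x' t) = above m k (x' + a * t) (b * t).

(** The trivial germ [a = 0], [b = 1] is allowed, so that all maps of a finite list can share one
    segment. *)
Definition first_shear (C e m k a b : R) (f : map2) : Prop :=
  C < e /\ 0 < b /\
  (forall x y, x < C -> f (x, y) = (x, y)) /\
  (forall x y, C < x < e -> y <= m * x + k -> f (x, y) = (x, y)) /\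
  (forall x, C < x < e -> shear_at m k x a b f).

(** With the displacements of the pieces in [L], each face is either fixed pointwise or moved at
    every point. *)
Definition affine_cells (L : list functional) (f : map2) : Prop :=
  forall z, exists A, (forall z', same_signs L z z' -> f z' = app A z') /\
    In (xshift A) L /\ In (yshift A) L.

(** The arrangements of all the maps are united and enlarged by the displacements; the axis
    [(0, 1, 0)] is there to control vertical lines in [transport]. *)
Lemma common_cells l :
  (forall f, In f l -> cellwise_affine f) ->
  exists L, In (0, 1, 0) L /\ forall f, In f l -> affine_cells L f.
Proof.
induction l as [|f l IH]; intros H; [exists [(0, 1, 0)]; split; [now left|intros ? []]|].
destruct IH as [L [HL IH]]; [intros; apply H; now right|].
destruct (H f (or_introl eq_refl)) as [L' [As [_ HA]]].
exists (L ++ L' ++ map xshift As ++ map yshift As).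
split; [apply in_or_app; now left|].
intros g [<-|Hg] z.
- destruct (HA z) as [A [HAs E]]; exists A; split; [|split].
  + intros z' Hz'; apply E; eapply same_signs_incl; [|exact Hz'].
    apply incl_appr, incl_appl, incl_refl.
  + apply in_or_app; right; apply in_or_app; right; apply in_or_app; left; now apply in_map.
  + apply in_or_app; right; apply in_or_app; right; apply in_or_app; right; now apply in_map.
- destruct (IH g Hg z) as [A [E [E1 E2]]]; exists A; split; [|split].
  + intros z' Hz'; apply E; eapply same_signs_incl; [|exact Hz']; apply incl_appl, incl_refl.
  + apply in_or_app; now left.
  + apply in_or_app; now left.
Qed.

Lemma sgneq_zero a b : sgneq a b -> a = 0 -> b = 0.
Proof.
intros [H1 H2] ->; destruct (Rtotal_order b 0) as [K|[K|K]]; [|exact K|]; exfalso; lra.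
Qed.

Lemma moved_same_signs L f z z' :
  affine_cells L f -> same_signs L z z' -> f z <> z -> f z' <> z'.
Proof.
intros HC Hs Hm E; apply Hm; destruct (HC z) as [A [EA [E1 E2]]].
rewrite (EA z' Hs) in E; rewrite (EA z (same_signs_refl _ _)).
assert (S1 := Hs _ E1); assert (S2 := Hs _ E2); apply sgneq_sym in S1, S2.
assert (F1 := sgneq_zero _ _ S1); assert (F2 := sgneq_zero _ _ S2).
rewrite !ev_xshift in F1; rewrite !ev_yshift in F2; rewrite E in F1, F2.
specialize (F1 (Rminus_diag_eq _ _ eq_refl)); specialize (F2 (Rminus_diag_eq _ _ eq_refl)).
destruct z as [x y]; apply injective_projections; simpl in *; lra.
Qed.

Lemma moved_open f z :
  continuous_R2 f -> f z <> z ->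
  exists d, 0 < d /\
    forall q, Rabs (fst q - fst z) < d -> Rabs (snd q - snd z) < d -> f q <> q.
Proof.
intros Hf Hz.
assert (0 < Rabs (fst (f z) - fst z) + Rabs (snd (f z) - snd z)) as P.
{ assert (P1 := Rabs_pos (fst (f z) - fst z)); assert (P2 := Rabs_pos (snd (f z) - snd z)).
  apply Rnot_le_lt; intros N; apply Hz, injective_projections; apply Rminus_diag_uniq;
  destruct (Req_dec (fst (f z) - fst z) 0) as [F1|F1];
  destruct (Req_dec (snd (f z) - snd z) 0) as [F2|F2]; auto;
  try apply Rabs_pos_lt in F1; try apply Rabs_pos_lt in F2; lra. }
(* The total displacement at [z]. Near [z], each coordinate of the point and of its image varies by
   less than [s / 4], too little to close the gap [s]. *)
set (s := Rabs _ + Rabs _) in P.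
destruct (Hf z (s / 4)) as [d [Hd K]]; [lra|].
exists (Rmin d (s / 4)); split; [apply Rmin_glb_lt; lra|].
intros q H1 H2 E; apply Rmin_Rgt in H1 as [H1 H1'], H2 as [H2 H2'].
destruct (K q H1 H2) as [K1 K2]; rewrite E in K1, K2.
apply Rgt_lt in H1', H2'; revert K1 K2 H1' H2'; unfold s, Rabs.
repeat destruct Rcase_abs; lra.
Qed.

Lemma infimum (E : R -> Prop) :
  (forall x, E x -> 0 <= x) -> (exists x, E x) ->
  exists c, (forall x, E x -> c <= x) /\ forall eps, 0 < eps -> exists x, E x /\ x < c + eps.
Proof.
intros H0 [x0 Hx0].
destruct (completeness (fun x => E (- x))) as [s [Hs1 Hs2]].
- exists 0; intros x Hx; apply H0 in Hx; lra.
- exists (- x0); now rewrite Ropp_involutive.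
- exists (- s); split.
  + intros x Hx; assert (- x <= s) by (apply Hs1; now rewrite Ropp_involutive); lra.
  + intros eps He; apply NNPP; intros N.
    assert (s <= s - eps); [|lra].
    apply Hs2; intros x Hx; apply Rnot_lt_le; intros Hl; apply N; exists (- x); split; [exact Hx|lra].
Qed.

(** In the third case [u] vanishes on the line [y = m x + k], hence is a multiple of the height
    above it. *)
Definition constant_along (C e m k : R) (u : functional) : Prop :=
  (forall x, C < x < e -> 0 < ev u (x, m * x + k)) \/
  (forall x, C < x < e -> ev u (x, m * x + k) < 0) \/
  (forall x t, ev u (above m k x t) = ycoef u * t).

(** Let [C] be the infimum of the moved abscissas, [x1] a moved abscissa in a strip without
    crossings, and [Y] the infimum of the moved heights over [x1]. The point [(x1, Y)] lies on a
    line of [L], which is the line sought; [transport] compares every other fibre of the strip with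
    the one over [x1]. *)
Lemma first_line (L : list functional) (moved : pt -> Prop) :
  In (0, 1, 0) L ->
  (forall z z', same_signs L z z' -> moved z -> moved z') ->
  (forall z, moved z -> exists d, 0 < d /\
    forall q, Rabs (fst q - fst z) < d -> Rabs (snd q - snd z) < d -> moved q) ->
  (forall z, moved z -> in_I2 z) -> (exists z, moved z) ->
  exists C e m k, C < e /\
    (forall x y, x < C -> ~ moved (x, y)) /\
    (forall x y, C < x < e -> y <= m * x + k -> ~ moved (x, y)) /\
    (forall u, In u L -> constant_along C e m k u) /\
    exists x, C < x < e /\ forall r, 0 < r -> exists t, 0 < t < r /\ moved (above m k x t).
Proof.
intros HL Hss Hop HI [[x0 y0] H0].
destruct (infimum (fun x => exists y, moved (x, y))) as [C [HC1 HC2]].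
{ intros x [y Hy]; apply (HI _ Hy). }
{ now exists x0, y0. }
(* The moved set is open, so the infimum is not attained; the same holds for [Y] below. *)
assert (HC3 : forall x y, moved (x, y) -> C < x).
{ intros x y Hxy; destruct (Hop _ Hxy) as [d [Hd K]].
  assert (M : moved (x - d / 2, y)).
  { apply K; simpl; [|rewrite Rminus_diag, Rabs_R0; exact Hd].
    replace (_ - _) with (- (d / 2)) by ring; rewrite Rabs_Ropp, Rabs_right; lra. }
  assert (C <= x - d / 2) by (apply HC1; now exists y); lra. }
destruct (noncrossing_strip L C) as [e [He HN]].
destruct (HC2 (e - C)) as [x1 [[y1 M1] Hx1]]; [lra|].
assert (Sx1 : C < x1 < e) by (split; [now apply (HC3 _ y1)|lra]).
destruct (infimum (fun y => moved (x1, y))) as [Y [HY1 HY2]].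
{ intros y Hy; apply (HI _ Hy). }
{ now exists y1. }
assert (HY3 : forall y, y <= Y -> ~ moved (x1, y)).
{ intros y Hy Hm; destruct (Hop _ Hm) as [d [Hd K]].
  assert (M : moved (x1, y - d / 2)).
  { apply K; simpl; [rewrite Rminus_diag, Rabs_R0; exact Hd|].
    replace (_ - _) with (- (d / 2)) by ring; rewrite Rabs_Ropp, Rabs_right; lra. }
  apply HY1 in M; lra. }
(* Otherwise a moved point just above [(x1, Y)] would lie in the same face, and [(x1, Y)] would be
   moved. *)
assert (exists u0, In u0 L /\ ycoef u0 <> 0 /\ ev u0 (x1, Y) = 0) as [u0 [Hu0 [N0 E0]]].
{ apply NNPP; intros N.
  destruct (nonzero_signs_near L (x1, Y)) as [d [Hd K]].
  destruct (HY2 d Hd) as [y [My Hy]]; assert (Hy' := HY1 _ My).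
  apply (HY3 Y (Rle_refl Y)), (Hss (x1, y)); [|exact My].
  intros u Hu; apply sgneq_sym; destruct (Req_dec (ycoef u) 0) as [Z|Z].
  - replace (ev u (x1, y)) with (ev u (x1, Y)); [apply sgneq_refl|].
    unfold ev; fold (ycoef u); simpl; rewrite Z; ring.
  - apply K; simpl; [rewrite Rminus_diag, Rabs_R0; exact Hd|apply Rabs_def1; lra|exact Hu|].
    intros E; apply N; now exists u. }
set (m := - fst (fst u0) / ycoef u0); set (k := - snd u0 / ycoef u0).
assert (Hh : forall x, height u0 x = m * x + k) by (intros; unfold height, m, k; field; exact N0).
assert (HYx1 : m * x1 + k = Y).
{ rewrite <- Hh; rewrite ev_height in E0 by exact N0; apply Rmult_integral in E0; lra. }
assert (Hcross : forall u x, ev u (x, m * x + k) = crossing u u0 x / ycoef u0).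
{ intros; unfold ev, crossing, m, k, ycoef in *; simpl; field; exact N0. }
(* On the line of [u0], the functional [u] equals its crossing with [u0] up to a constant factor. *)
assert (HD : forall u, In u L -> constant_along C e m k u).
{ intros u Hu; destruct (HN u u0 Hu Hu0) as [H|[H|H]].
  - destruct (Rdichotomy _ _ N0) as [P|P]; [right; left|left];
      intros x Hx; rewrite Hcross; specialize (H x Hx); apply Rinv_lt_0_compat in P
      || apply Rinv_0_lt_compat in P; unfold Rdiv; nra.
  - destruct (Rdichotomy _ _ N0) as [P|P]; [left|right; left];
      intros x Hx; rewrite Hcross; specialize (H x Hx); apply Rinv_lt_0_compat in P
      || apply Rinv_0_lt_compat in P; unfold Rdiv; nra.
  - right; right; intros x t.
    replace (ev u (above m k x t)) with (ev u (x, m * x + k) + ycoef u * t)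
      by (unfold ev, above, ycoef; simpl; ring).
    rewrite Hcross, H; field; exact N0. }
exists C, e, m, k; split; [exact He|split; [|split; [|split; [exact HD|]]]].
- intros x y Hx Hm; apply HC3 in Hm; lra.
(* Transport preserves the sign of [u0], so a moved point on or below the line would yield one over
   [x1] at height at most [Y]. *)
- intros x y Hx Hy Hm; destruct (transport L C e x x1 y HN HL Hx Sx1) as [y' Hs].
  assert (Hu := Hs _ Hu0); rewrite !ev_height, !Hh, HYx1 in Hu by exact N0.
  apply sgneq_mult_cancel in Hu; [|exact N0].
  apply (HY3 y'); [destruct Hu; lra|]; now apply (Hss (x, y)).
- exists x1; split; [exact Sx1|]; intros r Hr; destruct (HY2 r Hr) as [y [My Hy]].
  exists (y - Y); split.
  + destruct (Rle_or_lt y Y) as [K|K]; [|lra]; exfalso; now apply (HY3 y).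
  + unfold above; rewrite HYx1; now replace (Y + (y - Y)) with y by ring.
Qed.

Lemma signs_above L C e m k x :
  (forall u, In u L -> constant_along C e m k u) -> C < x < e ->
  exists r, 0 < r /\ forall x' t, Rabs (x' - x) < r -> 0 < t < r ->
    forall u, In u L ->
      ((forall x, C < x < e -> 0 < ev u (x, m * x + k)) -> 0 < ev u (above m k x' t)) /\
      ((forall x, C < x < e -> ev u (x, m * x + k) < 0) -> ev u (above m k x' t) < 0).
Proof.
intros HL Hx; destruct (nonzero_signs_near L (x, m * x + k)) as [d [Hd K]].
set (c := 1 + Rabs m); assert (Hm := Rabs_pos m).
assert (Hc : 0 < c) by (unfold c; lra).
exists (Rmin d (d / (1 + c))); split; [apply Rmin_glb_lt; [lra|apply Rdiv_lt_0_compat; lra]|].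
intros x' t H1 [H2 H3] u Hu.
apply Rmin_Rgt in H1 as [H1 H1'], H3 as [H3 H3'].
assert (E : d = d / (1 + c) * (1 + c)) by (field; lra).
assert (S : ev u (x, m * x + k) <> 0 -> sgneq (ev u (x, m * x + k)) (ev u (above m k x' t))).
{ apply K; simpl; [exact H1| |exact Hu].
  replace (_ - _) with (m * (x' - x) + t) by ring.
  eapply Rle_lt_trans; [apply Rabs_triang|]; rewrite Rabs_mult, (Rabs_right t) by lra.
  assert (B := Rabs_pos (x' - x)); unfold c in *; nra. }
split; intros H; specialize (H x Hx); destruct S; lra.
Qed.

(** A functional that is nonzero on the segment keeps its sign nearby, and one that vanishes there
    is [ycoef u * t], of constant sign for [t > 0]. So one face contains all points just above the
    segment. *)
Lemma same_signs_above L C e m k :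
  (forall u, In u L -> constant_along C e m k u) ->
  forall x1 x2, C < x1 < e -> C < x2 < e ->
  exists r, 0 < r /\ forall x t x' t', Rabs (x - x1) < r -> 0 < t < r ->
    Rabs (x' - x2) < r -> 0 < t' < r ->
    same_signs L (above m k x t) (above m k x' t').
Proof.
intros HL x1 x2 Hx1 Hx2.
destruct (signs_above L C e m k x1 HL Hx1) as [r1 [Hr1 K1]].
destruct (signs_above L C e m k x2 HL Hx2) as [r2 [Hr2 K2]].
exists (Rmin r1 r2); split; [now apply Rmin_glb_lt|].
assert (M1 := Rmin_l r1 r2); assert (M2 := Rmin_r r1 r2).
intros x t x' t' Ha Ht Ha' Ht' u Hu.
destruct (K1 x t) with (u := u) as [P1 N1]; try assumption; try lra.
destruct (K2 x' t') with (u := u) as [P2 N2]; try assumption; try lra.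
destruct (HL u Hu) as [H|[H|H]].
- specialize (P1 H); specialize (P2 H); split; lra.
- specialize (N1 H); specialize (N2 H); split; lra.
- rewrite !H; destruct (Rtotal_order (ycoef u) 0) as [Q|[Q|Q]].
  + assert (ycoef u * t < 0 /\ ycoef u * t' < 0) by nra; split; lra.
  + rewrite Q, !Rmult_0_l; apply sgneq_refl.
  + assert (0 < ycoef u * t /\ 0 < ycoef u * t') by nra; split; lra.
Qed.

Lemma ev_limit_zero u x y :
  (forall eps, 0 < eps -> exists d, 0 < d /\ forall t, 0 < t < d -> Rabs (ev u (x, y + t)) < eps) ->
  ev u (x, y) = 0.
Proof.
intros H; apply NNPP; intros N.
set (v := ev u (x, y)) in *; set (c := Rabs (ycoef u)).
assert (P := Rabs_pos_lt _ N); assert (Hc : 0 <= c) by apply Rabs_pos.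
destruct (H (Rabs v / 2)) as [d [Hd K]]; [lra|].
assert (Q : 0 < Rabs v / (4 * (c + 1))) by (apply Rdiv_lt_0_compat; lra).
assert (E : Rabs v / (4 * (c + 1)) * (4 * (c + 1)) = Rabs v) by (field; lra).
set (h := Rabs v / (4 * (c + 1))) in *.
set (t := Rmin (d / 2) h).
assert (M1 : t <= d / 2) by apply Rmin_l; assert (M2 : t <= h) by apply Rmin_r.
assert (Ht : 0 < t) by (apply Rmin_glb_lt; lra).
specialize (K t ltac:(lra)).
replace (ev u (x, y + t)) with (v + ycoef u * t) in K by (unfold v, ev, ycoef; simpl; ring).
assert (T := Rabs_triang (v + ycoef u * t) (- (ycoef u * t))).
replace (v + ycoef u * t + - (ycoef u * t)) with v in T by ring.
rewrite Rabs_Ropp, Rabs_mult, (Rabs_right t) in T by lra; fold c in T; nra.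
Qed.

(** The displacement of [f] tends to zero at a fixed point, and just above it this is the
    displacement of [A]. *)
Lemma fixed_by_continuity f A x y r :
  continuous_R2 f -> f (x, y) = (x, y) -> 0 < r ->
  (forall t, 0 < t < r -> f (x, y + t) = app A (x, y + t)) ->
  ev (xshift A) (x, y) = 0 /\ ev (yshift A) (x, y) = 0.
Proof.
intros Hf Hp Hr HA.
assert (K : forall eps, 0 < eps -> exists d, 0 < d /\ forall t, 0 < t < d ->
  Rabs (ev (xshift A) (x, y + t)) < eps /\ Rabs (ev (yshift A) (x, y + t)) < eps).
{ intros eps He; destruct (Hf (x, y) (eps / 2)) as [d [Hd K]]; [lra|].
  exists (Rmin (Rmin d r) (eps / 2)); split; [repeat apply Rmin_glb_lt; lra|].
  intros t [T0 T]; apply Rmin_Rgt in T as [T T3]; apply Rmin_Rgt in T as [T1 T2].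
  rewrite ev_xshift, ev_yshift, <- HA by lra.
  destruct (K (x, y + t)) as [K1 K2]; simpl.
  - rewrite Rminus_diag, Rabs_R0; exact Hd.
  - apply Rabs_def1; lra.
  - rewrite Hp in K1, K2; simpl in K1, K2; apply Rabs_def2 in K1, K2; simpl.
    split; apply Rabs_def1; lra. }
split; apply ev_limit_zero; intros eps He; destruct (K eps He) as [d [Hd H]];
  exists d; split; auto; intros t Ht; now apply H.
Qed.

Lemma Rabs_diag_lt x r : 0 < r -> Rabs (x - x) < r.
Proof. now rewrite Rminus_diag, Rabs_R0. Qed.

Lemma small_multiple a d : 0 < d -> exists r, 0 < r /\ forall t, 0 < t < r -> Rabs (a * t) < d.
Proof.
intros Hd; assert (Ha := Rabs_pos a); exists (d / (Rabs a + 1)).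
split; [apply Rdiv_lt_0_compat; lra|]; intros t [H0 H1].
assert (E : d / (Rabs a + 1) * (Rabs a + 1) = d) by (field; lra).
rewrite Rabs_mult, (Rabs_right t) by lra; nra.
Qed.

(** A single affine piece [A] is valid just above the whole segment. Its displacements vanish at one
    point of the segment by continuity, hence along the whole line, and are therefore multiples of
    the height [t]. *)
Lemma first_shear_exists L C e m k f :
  plane_PL f -> affine_cells L f -> C < e ->
  (forall u, In u L -> constant_along C e m k u) ->
  (forall x y, x < C -> f (x, y) = (x, y)) ->
  (forall x y, C < x < e -> y <= m * x + k -> f (x, y) = (x, y)) ->
  exists a b, first_shear C e m k a b f.
Proof.
intros [_ [Hc [_ [g [[gf _] _]]]]] HA He HL Hleft Hbelow.
set (x1 := (C + e) / 2); assert (Hx1 : C < x1 < e) by (unfold x1; lra).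
destruct (same_signs_above L C e m k HL x1 x1 Hx1 Hx1) as [r1 [Hr1 K1]].
set (z1 := above m k x1 (r1 / 2)).
destruct (HA z1) as [A [EA [E1 E2]]].
assert (EA' : forall x, C < x < e -> exists r, 0 < r /\ forall x' t,
  Rabs (x' - x) < r -> 0 < t < r -> f (above m k x' t) = app A (above m k x' t)).
{ intros x Hx; destruct (same_signs_above L C e m k HL x1 x Hx1 Hx) as [r [Hr K]].
  exists r; split; [exact Hr|]; intros x' t Hx' Ht; apply EA.
  assert (M1 := Rmin_l r r1); assert (M2 := Rmin_r r r1).
  assert (M3 : 0 < Rmin r r1) by now apply Rmin_glb_lt.
  (* An intermediate point over [x1], low enough for both comparisons. *)
  intros u Hu; apply sgneq_trans with (ev u (above m k x1 (Rmin r r1 / 2))).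
  - apply K1; try apply Rabs_diag_lt; auto; lra.
  - apply K; try apply Rabs_diag_lt; auto; lra. }
destruct (EA' x1 Hx1) as [r2 [Hr2 K2]].
destruct (fixed_by_continuity f A x1 (m * x1 + k) r2 Hc) as [F1 F2]; auto.
{ apply Hbelow; [exact Hx1|lra]. }
{ intros t Ht; apply K2; [now apply Rabs_diag_lt|exact Ht]. }
assert (G : forall u, In u L -> ev u (x1, m * x1 + k) = 0 ->
  forall x t, ev u (above m k x t) = ycoef u * t).
{ intros u Hu Z; destruct (HL u Hu) as [H|[H|H]]; [specialize (H x1 Hx1); lra..|exact H]. }
assert (G1 := G _ E1 F1); assert (G2 := G _ E2 F2); clear G F1 F2.
(* The term [m * a] corrects for the rise of the line under the horizontal displacement. *)
set (a := ycoef (xshift A)) in *; set (b := 1 + ycoef (yshift A) - m * a).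
assert (Eapp : forall x t, app A (above m k x t) = above m k (x + a * t) (b * t)).
{ intros x t; specialize (G1 x t); specialize (G2 x t).
  rewrite ev_xshift in G1; rewrite ev_yshift in G2.
  apply injective_projections; unfold above in *; simpl in *; [lra|].
  unfold b; lra. }
exists a, b; split; [exact He|split; [|split; [exact Hleft|split; [exact Hbelow|]]]].
(* If [b <= 0], a point just above the line is sent to a fixed point on or below it, against
   injectivity. The bound [r3] keeps the image inside the strip. *)
- apply Rnot_le_lt; intros Hb.
  destruct (small_multiple a (Rmin (x1 - C) (e - x1))) as [r3 [Hr3 K3]].
  { apply Rmin_glb_lt; lra. }
  set (t := Rmin r2 r3 / 2); assert (M1 := Rmin_l r2 r3); assert (M2 := Rmin_r r2 r3).
  assert (M3 : 0 < Rmin r2 r3) by now apply Rmin_glb_lt.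
  assert (Ht : 0 < t < r2 /\ t < r3) by (unfold t; lra).
  assert (Ef : f (above m k x1 t) = above m k (x1 + a * t) (b * t)).
  { rewrite K2, Eapp; [reflexivity|now apply Rabs_diag_lt|lra]. }
  specialize (K3 t ltac:(lra)); apply Rmin_Rgt in K3 as [K3 K4].
  apply Rgt_lt, Rabs_def2 in K3, K4.
  assert (Ef' : f (above m k (x1 + a * t) (b * t)) = above m k (x1 + a * t) (b * t)).
  { apply Hbelow; [lra|]; nra. }
  rewrite <- Ef in Ef' at 2; apply (f_equal g) in Ef'; rewrite !gf in Ef'.
  injection Ef' as X1 X2; assert (a * t = 0) by lra; rewrite H, Rplus_0_r in X2; nra.
- intros x Hx; destruct (EA' x Hx) as [r [Hr K]]; exists r; split; [exact Hr|].
  intros; rewrite K, Eapp; auto.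
Qed.

(** Apply [first_line] to the set of points moved by at least one map of the list. *)
Lemma common_first_shear l :
  (forall f, In f l -> plane_PL f) -> (exists f z, In f l /\ f z <> z) ->
  exists C e m k, C < e /\
    (forall f, In f l -> exists a b, first_shear C e m k a b f) /\
    exists f a b, In f l /\ first_shear C e m k a b f /\ ~ (a = 0 /\ b = 1).
Proof.
intros HG [f0 [z0 [Hf0 Hz0]]].
destruct (common_cells l) as [L [HL HC]]; [intros f Hf; now apply HG|].
destruct (first_line L (fun z => exists f, In f l /\ f z <> z) HL)
  as [C [e [m [k [He [H1 [H2 [H3 [x [Hx H4]]]]]]]]]].
- intros z z' Hs [f [Hf Hz]]; exists f; split; [exact Hf|].
  apply (moved_same_signs L f z); auto.
- intros z [f [Hf Hz]]; destruct (moved_open f z) as [d [Hd K]]; auto.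
  { now apply HG. }
  exists d; split; [exact Hd|]; intros q Q1 Q2; exists f; auto.
- intros z [f [Hf Hz]]; apply NNPP; intros N; apply Hz; now apply HG.
- now exists z0, f0.
- assert (HS : forall f, In f l -> exists a b, first_shear C e m k a b f).
  { intros f Hf; apply (first_shear_exists L); auto.
    - intros x' y Hx'; apply NNPP; intros N; apply (H1 x' y Hx'); now exists f.
    - intros x' y Hx' Hy; apply NNPP; intros N; apply (H2 x' y Hx' Hy); now exists f. }
  exists C, e, m, k; split; [exact He|split; [exact HS|]].
  destruct (same_signs_above L C e m k H3 x x Hx Hx) as [r [Hr K]].
  destruct (H4 r Hr) as [t [Ht [f [Hf Hm]]]].
  destruct (HS f Hf) as [a [b Hab]]; exists f, a, b; split; [exact Hf|split; [exact Hab|]].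
  (* A trivial germ fixes the points just above [x], but these share a face with a point moved by
     [f]. *)
  intros [-> ->]; destruct Hab as [_ [_ [_ [_ Hab]]]].
  destruct (Hab x Hx) as [r' [Hr' K']].
  assert (M1 := Rmin_l r r'); assert (M2 := Rmin_r r r').
  assert (M3 : 0 < Rmin r r') by now apply Rmin_glb_lt.
  apply (moved_same_signs L f (above m k x t) (above m k x (Rmin r r' / 2))); auto.
  + apply K; try apply Rabs_diag_lt; auto; lra.
  + rewrite K'; [|now apply Rabs_diag_lt|lra]; now rewrite Rmult_0_l, Rplus_0_r, Rmult_1_l.
Qed.

(** * The group of shear germs *)

Lemma above_inj m k x t x' t' : above m k x t = above m k x' t' -> x = x' /\ t = t'.
Proof. unfold above; intros H; injection H as -> H; split; [reflexivity|lra]. Qed.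

Lemma shear_at_id m k x : shear_at m k x 0 1 idm.
Proof.
exists 1; split; [lra|]; intros; unfold idm; now rewrite Rmult_0_l, Rplus_0_r, Rmult_1_l.
Qed.

(** The germ is the matrix with rows [(1, a)] and [(0, b)] acting on [(x, t)]; the formula is the
    matrix product. *)
Lemma shear_at_comp m k x a b a' b' f g :
  0 < b' -> shear_at m k x a b f -> shear_at m k x a' b' g ->
  shear_at m k x (a' + a * b') (b * b') (comp f g).
Proof.
intros Hb [r [Hr Hf]] [r' [Hr' Hg]].
destruct (small_multiple a' (r / 2)) as [s [Hs Ks]]; [lra|].
assert (Q : 0 < r / b') by now apply Rdiv_lt_0_compat.
(* Half of [r] is spent on the abscissa and half on the sideways shift [a' * t]; [r / b'] bounds the
   new height by [r]. *)
exists (Rmin (Rmin (r / 2) r') (Rmin s (r / b'))); split; [repeat apply Rmin_glb_lt; lra|].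
intros x' t Hx [T0 T]; apply Rmin_Rgt in Hx as [Hx _]; apply Rmin_Rgt in Hx as [X1 X2].
apply Rmin_Rgt in T as [T1 T2]; apply Rmin_Rgt in T1 as [_ T1]; apply Rmin_Rgt in T2 as [T2 T3].
unfold comp; rewrite Hg by lra; rewrite Hf.
- f_equal; ring.
- specialize (Ks t ltac:(lra)); replace (_ - _) with ((x' - x) + a' * t) by ring.
  eapply Rle_lt_trans; [apply Rabs_triang|]; lra.
- assert (E : b' * (r / b') = r) by (field; lra); nra.
Qed.

Lemma shear_at_inverse m k x a b f g :
  0 < b -> inverse_maps f g -> shear_at m k x a b f -> shear_at m k x (- a / b) (/ b) g.
Proof.
intros Hb [gf _] [r [Hr Hf]].
destruct (small_multiple (- a / b) (r / 2)) as [s [Hs Ks]]; [lra|].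
assert (Q : 0 < b * r) by now apply Rmult_lt_0_compat.
exists (Rmin (r / 2) (Rmin s (b * r))); split; [repeat apply Rmin_glb_lt; lra|].
intros x' t X [T0 T]; apply Rmin_Rgt in X as [X _].
apply Rmin_Rgt in T as [_ T]; apply Rmin_Rgt in T as [T1 T2].
rewrite <- (gf (above m k (x' + - a / b * t) (/ b * t))), Hf.
- f_equal; f_equal; field; lra.
- specialize (Ks t ltac:(lra)); replace (_ - _) with ((x' - x) + - a / b * t) by ring.
  eapply Rle_lt_trans; [apply Rabs_triang|]; lra.
- assert (E : b * (/ b * t) = t) by (field; lra).
  assert (0 < / b * t) by (apply Rmult_lt_0_compat; [now apply Rinv_0_lt_compat|lra]); nra.
Qed.

Lemma shear_at_unique m k x a b a' b' f :
  shear_at m k x a b f -> shear_at m k x a' b' f -> a = a' /\ b = b'.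
Proof.
intros [r [Hr H]] [r' [Hr' H']].
assert (M1 := Rmin_l r r'); assert (M2 := Rmin_r r r').
assert (M3 : 0 < Rmin r r') by now apply Rmin_glb_lt.
specialize (H x (Rmin r r' / 2) (Rabs_diag_lt _ _ Hr) ltac:(lra)).
specialize (H' x (Rmin r r' / 2) (Rabs_diag_lt _ _ Hr') ltac:(lra)).
rewrite H in H'; apply above_inj in H' as [E1 E2]; split; nra.
Qed.

(** * The left order *)

(** A positive cone of the matrix group: lexicographic, with [b] first and [a] on the kernel
    [b = 1]. *)
Definition positive_shear (a b : R) : Prop := 1 < b \/ (b = 1 /\ 0 < a).

Definition positive (f : map2) : Prop :=
  exists C e m k a b, first_shear C e m k a b f /\ positive_shear a b.

Lemma shear_at_moves m k x a b f d :
  shear_at m k x a b f -> ~ (a = 0 /\ b = 1) -> 0 < d ->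
  exists t, 0 < t < d /\ f (above m k x t) <> above m k x t.
Proof.
intros [r [Hr H]] N Hd.
assert (M1 := Rmin_l r d); assert (M2 := Rmin_r r d).
assert (M3 : 0 < Rmin r d) by now apply Rmin_glb_lt.
exists (Rmin r d / 2); split; [lra|].
rewrite H; [|now apply Rabs_diag_lt|lra].
intros E; apply above_inj in E as [E1 E2]; apply N; split; nra.
Qed.

(** A nontrivial germ moves points over every abscissa just right of [C'], and [f] moves nothing
    left of [C]. *)
Lemma first_shear_left C e m k a b C' e' m' k' a' b' f :
  first_shear C e m k a b f -> first_shear C' e' m' k' a' b' f ->
  ~ (a' = 0 /\ b' = 1) -> C <= C'.
Proof.
intros [_ [_ [Hl _]]] [He' [_ [_ [_ Hs']]]] N; apply Rnot_lt_le; intros HC.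
set (x := (C' + Rmin C e') / 2).
assert (M1 := Rmin_l C e'); assert (M2 := Rmin_r C e').
assert (M3 : C' < Rmin C e') by now apply Rmin_glb_lt.
destruct (shear_at_moves m' k' x a' b' f 1) as [t [_ Ht]]; [apply Hs'; unfold x; lra|exact N|lra|].
apply Ht, Hl; unfold x; lra.
Qed.

Lemma first_shear_below C e m k a b e' m' k' a' b' f x :
  first_shear C e m k a b f -> first_shear C e' m' k' a' b' f ->
  ~ (a' = 0 /\ b' = 1) -> C < x < e -> C < x < e' -> m * x + k <= m' * x + k'.
Proof.
intros [_ [_ [_ [Hb _]]]] [_ [_ [_ [_ Hs']]]] N Hx Hx'; apply Rnot_lt_le; intros Hlt.
destruct (shear_at_moves m' k' x a' b' f (m * x + k - (m' * x + k'))) as [t [Ht Hm]];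
  [now apply Hs'|exact N|lra|].
apply Hm, Hb; [exact Hx|lra].
Qed.

(** Makes [positive] independent of the chosen segment. Comparison in both directions equates the
    left ends and then the lines, which are determined by two abscissas of the common strip. *)
Lemma first_shear_unique C e m k a b C' e' m' k' a' b' f :
  first_shear C e m k a b f -> first_shear C' e' m' k' a' b' f ->
  ~ (a = 0 /\ b = 1) -> ~ (a' = 0 /\ b' = 1) -> a = a' /\ b = b'.
Proof.
intros H H' N N'.
assert (EC : C = C') by (apply Rle_antisym; eapply first_shear_left; eassumption).
subst C'.
assert (M1 := Rmin_l e e'); assert (M2 := Rmin_r e e').
assert (M3 : C < Rmin e e') by (apply Rmin_glb_lt; [apply H|apply H']).
assert (El : forall x, C < x < Rmin e e' -> m * x + k = m' * x + k').
{ intros x Hx; apply Rle_antisym; eapply first_shear_below; try eassumption; lra. }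
set (x1 := (C + Rmin e e') / 2); set (x2 := (x1 + Rmin e e') / 2).
assert (E1 := El x1 ltac:(unfold x1; lra)).
assert (E2 := El x2 ltac:(unfold x2, x1; lra)).
assert (Hx : x2 - x1 <> 0) by (unfold x2, x1; lra).
assert (m = m').
{ apply Rmult_eq_reg_r with (x2 - x1); [lra|exact Hx]. }
subst m'; assert (k = k') by lra; subst k'.
apply (shear_at_unique m k x1 a b a' b' f); [apply H|apply H']; unfold x1; lra.
Qed.

Lemma first_shear_comp C e m k a b a' b' f g :
  first_shear C e m k a b f -> first_shear C e m k a' b' g ->
  first_shear C e m k (a' + a * b') (b * b') (comp f g).
Proof.
intros [He [Hb [H1 [H2 H3]]]] [_ [Hb' [H1' [H2' H3']]]].
split; [exact He|split; [now apply Rmult_lt_0_compat|split; [|split]]].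
- intros x y Hx; unfold comp; now rewrite H1', H1.
- intros x y Hx Hy; unfold comp; now rewrite H2', H2.
- intros x Hx; apply shear_at_comp; auto.
Qed.

Lemma first_shear_inverse C e m k a b f g :
  inverse_maps f g -> first_shear C e m k a b f ->
  first_shear C e m k (- a / b) (/ b) g.
Proof.
intros Hi [He [Hb [H1 [H2 H3]]]].
split; [exact He|split; [now apply Rinv_0_lt_compat|split; [|split]]].
- intros x y Hx; rewrite <- (H1 x y Hx) at 1; apply Hi.
- intros x y Hx Hy; rewrite <- (H2 x y Hx Hy) at 1; apply Hi.
- intros x Hx; apply (shear_at_inverse m k x a b f g); auto.
Qed.

Lemma positive_shear_nontrivial a b : positive_shear a b -> ~ (a = 0 /\ b = 1).
Proof. unfold positive_shear; lra. Qed.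

Lemma positive_not_id f : positive f -> exists z, f z <> z.
Proof.
intros [C [e [m [k [a [b [H P]]]]]]]; destruct H as [He [_ [_ [_ H]]]].
destruct (shear_at_moves m k ((C + e) / 2) a b f 1) as [t [_ Ht]];
  [apply H; lra|now apply positive_shear_nontrivial|lra|].
eexists; exact Ht.
Qed.

(** On a segment common to both maps each germ is trivial or positive by uniqueness, and one is
    nontrivial. The product of the two germs is then positive. *)
Lemma positive_comp f g :
  plane_PL f -> plane_PL g -> positive f -> positive g -> positive (comp f g).
Proof.
intros Gf Gg Pf Pg; destruct (positive_not_id f Pf) as [z Hz].
destruct (common_first_shear [f; g]) as [C [e [m [k [_ [H [h [c [d [Hh [Hcd N]]]]]]]]]]].
{ intros ? [<-|[<-|[]]]; assumption. }
{ exists f, z; split; [now left|exact Hz]. }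
assert (K : forall h, positive h -> (exists a b, first_shear C e m k a b h) ->
  exists a b, first_shear C e m k a b h /\ ((a = 0 /\ b = 1) \/ positive_shear a b)).
{ intros h' [C' [e' [m' [k' [a' [b' [Hs' P]]]]]]] [a [b Hs]]; exists a, b; split; [exact Hs|].
  destruct (classic (a = 0 /\ b = 1)) as [T|T]; [now left|right].
  destruct (first_shear_unique _ _ _ _ _ _ _ _ _ _ _ _ _ Hs Hs' T
    (positive_shear_nontrivial _ _ P)) as [-> ->]; exact P. }
destruct (K f Pf (H f ltac:(simpl; tauto))) as [a [b [Hf Sf]]].
destruct (K g Pg (H g ltac:(simpl; tauto))) as [a' [b' [Hg Sg]]].
exists C, e, m, k, (a' + a * b'), (b * b'); split; [now apply first_shear_comp|].
assert (D : positive_shear a b \/ positive_shear a' b').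
{ assert (Hx : C < (C + e) / 2 < e) by (destruct Hf; lra).
  destruct Hcd as [_ [_ [_ [_ Hcd]]]]; specialize (Hcd _ Hx).
  destruct Hf as [_ [_ [_ [_ Hf]]]], Hg as [_ [_ [_ [_ Hg]]]].
  specialize (Hf _ Hx); specialize (Hg _ Hx).
  destruct Hh as [<-|[<-|[]]].
  - destruct (shear_at_unique _ _ _ _ _ _ _ _ Hcd Hf); subst; tauto.
  - destruct (shear_at_unique _ _ _ _ _ _ _ _ Hcd Hg); subst; tauto. }
clear - Sf Sg D; unfold positive_shear in *.
destruct Sf as [[-> ->]|Sf].
- rewrite Rmult_0_l, Rplus_0_r, Rmult_1_l; lra.
- destruct Sg as [[-> ->]|Sg]; [rewrite Rplus_0_l, !Rmult_1_r; lra|].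
  destruct Sf as [Sf|[-> Sf]], Sg as [Sg|[-> Sg]]; [left; nra|left; lra|left; lra|right; lra].
Qed.

Lemma positive_or_inverse f g :
  plane_PL f -> inverse_maps f g -> f <> idm -> positive f \/ positive g.
Proof.
intros Gf Hi Hne.
assert (exists z, f z <> z) as [z Hz].
{ apply NNPP; intros N; apply Hne, functional_extensionality; intros z.
  apply NNPP; intros K; apply N; now exists z. }
destruct (common_first_shear [f]) as [C [e [m [k [_ [_ [h [a [b [[<-|[]] [H N]]]]]]]]]]].
{ intros ? [<-|[]]; exact Gf. }
{ exists f, z; split; [now left|exact Hz]. }
assert (Hb : 0 < b) by apply H.
destruct (classic (positive_shear a b)) as [P|P].
- left; now exists C, e, m, k, a, b.
- right; exists C, e, m, k, (- a / b), (/ b).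
  split; [now apply (first_shear_inverse C e m k a b f g)|].
  unfold positive_shear in *.
  destruct (Rtotal_order b 1) as [B|[->|B]]; [left|right|exfalso; lra].
  + rewrite <- Rinv_1; apply Rinv_lt_contravar; lra.
  + split; [apply Rinv_1|]; lra.
Qed.

Lemma inverse_maps_sym f g : inverse_maps f g -> inverse_maps g f.
Proof. intros [H1 H2]; split; assumption. Qed.

Lemma inverse_maps_comp f f' g g' :
  inverse_maps f f' -> inverse_maps g g' -> inverse_maps (comp f g) (comp g' f').
Proof.
intros [H1 H2] [H3 H4]; split; intros p; unfold comp; [now rewrite H1|now rewrite H4].
Qed.

(** [f] precedes [g] when the inverse of [f] composed with [g] is positive. Transitivity is closure
    of the positive maps under composition, and left multiplication cancels. *)
Lemma PL_I2_left_orderable : left_orderable_PL.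
Proof.
exists (fun f g => exists f', inverse_maps f f' /\ positive (comp f' g)).
assert (I : forall f, PL_I2 f -> exists f', inverse_maps f f' /\ plane_PL f').
{ intros f Hf; apply PL_I2_plane_PL in Hf as Gf; assert (Gf' := Gf).
  destruct Gf' as [_ [_ [_ [f' [Hi _]]]]]; exists f'; split; [exact Hi|].
  now apply (plane_PL_inverse f). }
split; [|split; [|split]].
- intros f Hf [f' [[Hi _] P]]; apply positive_not_id in P as [z Hz]; apply Hz, Hi.
- intros f g h Hf Hg Hh [f' [Hif Pfg]] [g' [Hig Pgh]]; exists f'; split; [exact Hif|].
  apply PL_I2_plane_PL in Hf, Hg, Hh.
  replace (comp f' h) with (comp (comp f' g) (comp g' h)).
  + apply (plane_PL_inverse f f') in Hf; [|exact Hif].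
    apply positive_comp; try assumption; apply plane_PL_comp; try assumption.
    now apply (plane_PL_inverse g).
  + apply functional_extensionality; intros p; unfold comp; now rewrite (proj2 Hig).
- intros f g Hf Hg Hne; destruct (I f Hf) as [f' [Hif Gf']], (I g Hg) as [g' [Hig Gg']].
  apply PL_I2_plane_PL in Hf, Hg.
  destruct (positive_or_inverse (comp f' g) (comp g' f)) as [P|P].
  + now apply plane_PL_comp.
  + apply inverse_maps_comp; [now apply inverse_maps_sym|exact Hig].
  + intros E; apply Hne, functional_extensionality; intros p.
    assert (Ep : comp f' g p = p) by now rewrite E.
    rewrite <- Ep at 1; apply (proj2 Hif).
  + left; now exists f'.
  + right; now exists g'.
- intros f g h Hf _ _ [g' [Hig P]]; destruct (I f Hf) as [f' [Hif _]].
  exists (comp g' f'); split; [now apply inverse_maps_comp|].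
  replace (comp (comp g' f') (comp f h)) with (comp g' h); [exact P|].
  apply functional_extensionality; intros p; unfold comp; now rewrite (proj1 Hif).
Qed.

(** * Local indicability *)

(** [span l] is the subgroup of [R * Z] generated by the pairs in [l]. *)
Fixpoint span (l : list (R * Z)) (v : R) (z : Z) : Prop :=
  match l with
  | [] => v = 0 /\ z = 0%Z
  | (x, k) :: l' => exists n : Z, span l' (v - IZR n * x) (z - n * k)
  end.

Lemma span_zero l : span l 0 0.
Proof.
induction l as [|[x k] l IH]; simpl; [now split|]; exists 0%Z.
now replace (0 - IZR 0 * x) with 0 by ring.
Qed.

Lemma span_add l v z v' z' : span l v z -> span l v' z' -> span l (v + v') (z + z').
Proof.
revert v z v' z'; induction l as [|[x k] l IH]; simpl; intros v z v' z'.
- intros [-> ->] [-> ->]; split; [ring|reflexivity].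
- intros [n H] [n' H']; exists (n + n')%Z; rewrite plus_IZR.
  replace (v + v' - _) with (v - IZR n * x + (v' - IZR n' * x)) by ring.
  replace (z + z' - (n + n') * k)%Z with (z - n * k + (z' - n' * k))%Z by ring.
  now apply IH.
Qed.

Lemma span_mult l n v z : span l v z -> span l (IZR n * v) (n * z).
Proof.
revert v z; induction l as [|[x k] l IH]; simpl; intros v z.
- intros [-> ->]; split; [ring|lia].
- intros [q H]; exists (n * q)%Z; rewrite mult_IZR.
  replace (_ - _) with (IZR n * (v - IZR q * x)) by ring.
  replace (n * z - n * q * k)%Z with (n * (z - q * k))%Z by ring.
  now apply IH.
Qed.

Lemma span_opp l v z : span l v z -> span l (- v) (- z).
Proof.
intros H; apply (span_mult l (-1)) in H.
now replace (IZR (-1) * v) with (- v) in H by (simpl; ring);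
  replace (-1 * z)%Z with (- z)%Z in H by ring.
Qed.

Lemma span_in l x k : In (x, k) l -> span l x k.
Proof.
induction l as [|[y j] l IH]; simpl; [tauto|intros [E|E]].
- injection E as -> ->; exists 1%Z.
  replace (x - 1 * x) with 0 by ring; replace (k - 1 * k)%Z with 0%Z by ring; apply span_zero.
- exists 0%Z; replace (x - 0 * y) with x by ring; replace (k - 0 * j)%Z with k by ring; auto.
Qed.

Lemma span_scale l m v z :
  span (map (fun p => (fst p, (m * snd p)%Z)) l) v z -> exists z', z = (m * z')%Z /\ span l v z'.
Proof.
revert v z; induction l as [|[x k] l IH]; simpl; intros v z.
- intros [-> ->]; exists 0%Z; split; [lia|now split].
- intros [n H]; apply IH in H as [z' [E H]]; exists (z' + n * k)%Z; split; [lia|].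
  exists n; now replace (z' + n * k - n * k)%Z with z' by ring.
Qed.

Lemma span_zeros l v z : (forall x, In x l -> x = 0) ->
  span (map (fun x => (x, 0%Z)) l) v z -> v = 0 /\ z = 0%Z.
Proof.
revert v z; induction l as [|x l IH]; simpl; intros v z H; [tauto|].
intros [n K]; rewrite (H x) in K by tauto; apply IH in K as [E1 E2]; [|now auto].
split; [lra|lia].
Qed.

(** The functional is extended one generator at a time, after rescaling by [m]
    when [m] times the new generator lies in the previous subgroup. *)
Lemma integer_functional xs :
  (exists x, In x xs /\ x <> 0) ->
  exists l, map fst l = xs /\ (forall z, span l 0 z -> z = 0%Z) /\
    exists x k, In (x, k) l /\ k <> 0%Z.
Proof.
induction xs as [|x xs IH]; [intros [x [[] _]]|intros Hx].
destruct (classic (exists y, In y xs /\ y <> 0)) as [Hy|Hy].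
- destruct (IH Hy) as [l [Hl [Hf [y [k [Hyk Hk]]]]]].
  (* The condition [span l 0 z -> z = 0] says that the integers respect every relation among the
     reals. If [m * x] has value [w], then [x] should get [w / m], which rescaling by [m] makes
     integral; if no such [m] exists, any value is consistent and 0 is taken. *)
  destruct (classic (exists m w, m <> 0%Z /\ span l (IZR m * x) w)) as [[m [w [Hm Hw]]]|N].
  + exists ((x, w) :: map (fun p => (fst p, (m * snd p)%Z)) l); split; [|split].
    * simpl; f_equal; rewrite map_map; exact Hl.
    * intros z [n H]; apply span_scale in H as [z' [E H]].
      apply (span_mult l m) in H; apply (span_mult l n) in Hw.
      assert (S := span_add _ _ _ _ _ H Hw).
      replace (_ + _) with 0 in S by ring; apply Hf in S; lia.
    * exists y, (m * k)%Z; split; [|lia]; right; apply in_map_iff; now exists (y, k).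
  + exists ((x, 0%Z) :: l); split; [simpl; now f_equal|split].
    * intros z [n H]; apply span_opp in H.
      replace (- (0 - IZR n * x)) with (IZR n * x) in H by ring.
      assert (n = 0%Z) by (apply NNPP; intros Hn; apply N; now exists n, (- (z - n * 0))%Z).
      subst n; replace (IZR 0 * x) with 0 in H by ring; apply Hf in H; lia.
    * exists y, k; split; [now right|exact Hk].
- destruct Hx as [x' [[<-|Hx'] Nx]]; [|exfalso; apply Hy; now exists x'].
  exists ((x, 1%Z) :: map (fun x => (x, 0%Z)) xs); split; [|split].
  + simpl; f_equal; rewrite map_map; simpl; apply map_id.
  + intros z [n H]; apply span_zeros in H as [E1 E2].
    * assert (E : IZR n * x = 0) by lra; apply Rmult_integral in E as [E|E]; [|tauto].
      apply eq_IZR in E; lia.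
    * intros y Hin; apply NNPP; intros Ny; apply Hy; now exists y.
  + exists x, 1%Z; split; [now left|lia].
Qed.

(** * Surjections onto the integers *)

(** Descent by division: a positive element either divides all elements or leaves a nonzero
    remainder, which is a smaller positive element. The number [n] bounds the descent. *)
Lemma integer_subgroup_generator (S : Z -> Prop) :
  (forall x y, S x -> S y -> S (x + y)%Z) -> (forall x, S x -> S (- x)%Z) ->
  (exists x, S x /\ x <> 0%Z) ->
  exists d, d <> 0%Z /\ (forall q, S (q * d)%Z) /\ forall x, S x -> exists q, x = (q * d)%Z.
Proof.
intros Hadd Hopp [x0 [S0 N0]].
assert (Hmul : forall x, S x -> forall q, S (q * x)%Z).
{ intros x Sx.
  assert (Hn : forall n, S (Z.of_nat n * x)%Z).
  { induction n as [|n IH].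
    - replace (Z.of_nat 0 * x)%Z with (x + - x)%Z by lia; auto.
    - replace (Z.of_nat (Datatypes.S n) * x)%Z with (Z.of_nat n * x + x)%Z by lia; auto. }
  intros q; destruct (Z_le_gt_dec 0 q) as [Hq|Hq].
  - rewrite <- (Z2Nat.id q) by exact Hq; apply Hn.
  - replace (q * x)%Z with (- (Z.of_nat (Z.to_nat (- q)) * x))%Z by (rewrite Z2Nat.id; lia); auto. }
assert (K : forall n x, S x -> (0 < x)%Z -> (Z.to_nat x <= n)%nat ->
  exists d, (0 < d)%Z /\ S d /\ forall y, S y -> exists q, y = (q * d)%Z).
{ induction n as [|n IH]; intros x Sx Px Hx; [lia|].
  destruct (classic (forall y, S y -> exists q, y = (q * x)%Z)) as [A|A]; [now exists x|].
  apply not_all_ex_not in A as [y A]; apply imply_to_and in A as [Sy A].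
  assert (E := Z_div_mod_eq_full y x); assert (B := Z.mod_pos_bound y x Px).
  apply (IH (y mod x)%Z).
  - replace (y mod x)%Z with (y + (- (y / x)) * x)%Z by lia; auto.
  - destruct (Z.eq_dec (y mod x) 0) as [Z|Z]; [|lia].
    exfalso; apply A; exists (y / x)%Z; lia.
  - lia. }
destruct (K (Z.to_nat (Z.abs x0)) (Z.abs x0)) as [d [Pd [Sd Hd]]].
- destruct (Zabs_spec x0) as [[_ ->]|[_ ->]]; auto.
- lia.
- lia.
- exists d; split; [lia|split; auto].
Qed.

Lemma gen_comp l f g : gen l f -> gen l g -> gen l (comp f g).
Proof.
intros Hf Hg; induction Hf as [|s h Hs Hh IH|s t h Hs H1 H2 Hh IH]; [exact Hg|..].
- exact (gen_mul l s _ Hs IH).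
- exact (gen_mulinv l s t _ Hs H1 H2 IH).
Qed.

Lemma gen_in l s : In s l -> gen l s.
Proof. intros Hs; exact (gen_mul l s _ Hs (gen_one l)). Qed.

Lemma gen_in_inverse l s t : In s l -> inverse_maps s t -> gen l t.
Proof. intros Hs [H1 H2]; exact (gen_mulinv l s t _ Hs H1 H2 (gen_one l)). Qed.

(** [val] is the graph of a homomorphism to [R]. *)
Lemma surjection_onto_Z l (val : map2 -> R -> Prop) :
  val idm 0 ->
  (forall f g v w, val f v -> val g w -> val (comp f g) (v + w)) ->
  (forall f v w, val f v -> val f w -> v = w) ->
  (forall s, In s l -> exists t v, inverse_maps s t /\ val s v) ->
  (forall s t v, In s l -> inverse_maps s t -> val s v -> val t (- v)) ->
  (exists s v, In s l /\ val s v /\ v <> 0) ->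
  exists phi : map2 -> Z,
    (forall h1 h2, gen l h1 -> gen l h2 -> phi (comp h1 h2) = (phi h1 + phi h2)%Z) /\
    (forall z : Z, exists h, gen l h /\ phi h = z).
Proof.
intros Vid Vcomp Vuniq Vgen Vinv [s0 [v0 [Hs0 [Vs0 Nv0]]]].
assert (exists xs, (forall s v, In s l -> val s v -> In v xs) /\
  (forall x, In x xs -> exists s, In s l /\ val s x)) as [xs [X1 X2]].
{ clear Hs0 Vinv; induction l as [|s l IH]; [exists []; split; [intros ? ? []|intros ? []]|].
  destruct IH as [xs [X1 X2]]; [intros; apply Vgen; now right|].
  destruct (Vgen s (or_introl eq_refl)) as [_ [v [_ Hv]]]; exists (v :: xs); split.
  - intros s' v' [<-|Hs'] Hv'; [left; now apply (Vuniq s)|right; now apply (X1 s')].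
  - intros x [<-|Hx]; [exists s; split; [now left|exact Hv]|].
    destruct (X2 x Hx) as [s' [Hs' Hv']]; exists s'; split; [now right|exact Hv']. }
destruct (integer_functional xs) as [L [HL [Hf [x1 [k1 [Hin Hk1]]]]]].
{ exists v0; split; [now apply (X1 s0)|exact Nv0]. }
(* The graph of [val] followed by the integer functional on the group generated by the values of the
   generators. *)
set (P := fun h z => exists v, val h v /\ span L v z).
assert (Pcomp : forall f g z w, P f z -> P g w -> P (comp f g) (z + w)%Z).
{ intros f g z w [v [V1 S1]] [v' [V2 S2]]; exists (v + v').
  split; [now apply Vcomp|now apply span_add]. }
assert (Puniq : forall f z w, P f z -> P f w -> z = w).
{ intros f z w [v [V1 S1]] [v' [V2 S2]]; rewrite (Vuniq f v' v V2 V1) in S2.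
  apply span_opp in S2; assert (S := span_add _ _ _ _ _ S1 S2).
  rewrite Rplus_opp_r in S; apply Hf in S; lia. }
assert (Pgen : forall s t, In s l -> inverse_maps s t -> exists z, P s z /\ P t (- z)%Z).
{ intros s t Hs Hst; destruct (Vgen s Hs) as [_ [v [_ Hv]]].
  assert (Hx := X1 s v Hs Hv); rewrite <- HL in Hx; apply in_map_iff in Hx as [[x k] [E Hx]].
  simpl in E; subst x; apply span_in in Hx; exists k; split.
  - now exists v.
  - exists (- v); split; [now apply (Vinv s)|now apply span_opp]. }
(* An element of opposite value is built alongside, so that the set of values is closed under
   negation. *)
assert (Pall : forall h, gen l h -> exists z h', P h z /\ gen l h' /\ P h' (- z)%Z).
{ intros h Hh; induction Hh as [|s h Hs Hh [z [h' [Pz [Gz Pz']]]]|s t h Hs H1 H2 Hh [z [h' [Pz [Gz Pz']]]]].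
  - exists 0%Z, idm; assert (P idm 0%Z) by (exists 0; split; [exact Vid|apply span_zero]).
    repeat split; [assumption|constructor|assumption].
  - destruct (Vgen s Hs) as [t [_ [Hst _]]]; destruct (Pgen s t Hs Hst) as [w [W1 W2]].
    exists (w + z)%Z, (comp t h'); split; [now apply Pcomp|split].
    + apply gen_comp; [now apply (gen_in_inverse l s)|exact Gz].
    + replace (- (w + z))%Z with (- w + - z)%Z by lia; now apply Pcomp.
  - destruct (Pgen s t Hs (conj H1 H2)) as [w [W1 W2]].
    exists (- w + z)%Z, (comp s h'); split; [now apply Pcomp|split].
    + apply gen_comp; [now apply gen_in|exact Gz].
    + replace (- (- w + z))%Z with (w + - z)%Z by lia; now apply Pcomp. }
destruct (integer_subgroup_generator (fun z => exists h, gen l h /\ P h z)) as [d [Nd [Sd Hd]]].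
- intros x y [f [F1 F2]] [g [G1 G2]]; exists (comp f g); split; [now apply gen_comp|now apply Pcomp].
- intros x [f [F1 F2]]; destruct (Pall f F1) as [z [h' [Pz [Gz Pz']]]]; exists h'.
  rewrite (Puniq f x z F2 Pz); now split.
- assert (Hx1 : In x1 xs) by (rewrite <- HL; apply in_map_iff; now exists (x1, k1)).
  destruct (X2 x1 Hx1) as [s [Hs Hv]]; exists k1; split; [|exact Hk1].
  exists s; split; [now apply gen_in|]; exists x1; split; [exact Hv|now apply span_in].
(* The image is generated by [d], so dividing by [d] makes the homomorphism surjective. Off the
   generated subgroup the choice may be arbitrary. *)
- exists (fun h => epsilon (inhabits 0%Z) (fun q => P h (q * d)%Z)).
  assert (Hphi : forall h q, P h (q * d)%Z -> epsilon (inhabits 0%Z) (fun q => P h (q * d)%Z) = q).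
  { intros h q Hq; assert (E := epsilon_spec (inhabits 0%Z) (fun q => P h (q * d)%Z) (ex_intro _ q Hq)).
    apply (Puniq _ _ _ Hq), Z.mul_reg_r in E; [now symmetry|exact Nd]. }
  split.
  + intros h1 h2 G1 G2.
    destruct (Pall h1 G1) as [z1 [_ [P1 _]]], (Pall h2 G2) as [z2 [_ [P2 _]]].
    destruct (Hd z1) as [q1 ->]; [now exists h1|]; destruct (Hd z2) as [q2 ->]; [now exists h2|].
    rewrite (Hphi h1 q1 P1), (Hphi h2 q2 P2); apply Hphi.
    replace ((q1 + q2) * d)%Z with (q1 * d + q2 * d)%Z by ring; now apply Pcomp.
  + intros z; destruct (Sd z) as [h [G1 P1]]; exists h; split; [exact G1|now apply Hphi].
Qed.

Lemma gen_trivial l h : (forall s, In s l -> s = idm) -> gen l h -> h = idm.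
Proof.
intros Hl Hh; induction Hh as [|s h Hs Hh ->|s t h Hs H1 H2 Hh ->]; [reflexivity|now apply Hl|].
apply functional_extensionality; intros p; rewrite (Hl s Hs) in H1; apply H1.
Qed.

Lemma PL_I2_locally_indicable : locally_indicable_PL.
Proof.
intros l Hl [h [Gh Nh]].
assert (HG : forall f, In f l -> plane_PL f).
{ intros f Hf; apply PL_I2_plane_PL; now apply (proj1 (Forall_forall _ _) Hl). }
destruct (common_first_shear l HG) as [C [e [m [k [He [HS [f0 [a0 [b0 [Hf0 [H0 N0]]]]]]]]]]].
{ apply NNPP; intros N; apply Nh, (gen_trivial l); [|exact Gh]; intros s Hs.
  apply functional_extensionality; intros z; apply NNPP; intros Nz; apply N; now exists s, z. }
(* Germs at a single point of the segment suffice, since every shear fixes that point. *)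
set (x := (C + e) / 2).
assert (HS' : forall f a b, first_shear C e m k a b f -> 0 < b /\ shear_at m k x a b f).
{ intros f a b [_ [Hb [_ [_ H]]]]; split; [exact Hb|apply H; unfold x; lra]. }
assert (Hinv : forall s, In s l -> exists t a b, inverse_maps s t /\ 0 < b /\ shear_at m k x a b s).
{ intros s Hs; destruct (HS s Hs) as [a [b Hab]].
  destruct (HG s Hs) as [_ [_ [_ [t [Ht _]]]]]; exists t, a, b; auto. }
apply HS' in H0 as [Pb0 H0].
destruct (classic (exists s a b, In s l /\ 0 < b /\ shear_at m k x a b s /\ b <> 1))
  as [[s [a [b [Hs [Pb [Hab Nb]]]]]]|N].
- apply (surjection_onto_Z l (fun f v => exists a b, 0 < b /\ shear_at m k x a b f /\ v = ln b)).
  + exists 0, 1; split; [lra|split; [apply shear_at_id|now rewrite ln_1]].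
  + intros f g v w [a1 [b1 [P1 [S1 ->]]]] [a2 [b2 [P2 [S2 ->]]]].
    exists (a2 + a1 * b2), (b1 * b2); split; [now apply Rmult_lt_0_compat|split].
    * now apply shear_at_comp.
    * now rewrite ln_mult.
  + intros f v w [a1 [b1 [P1 [S1 ->]]]] [a2 [b2 [P2 [S2 ->]]]].
    now destruct (shear_at_unique _ _ _ _ _ _ _ _ S1 S2) as [-> ->].
  + intros s' Hs'; destruct (Hinv s' Hs') as [t [a' [b' [Ht [Pb' Hab']]]]].
    exists t, (ln b'); split; [exact Ht|]; now exists a', b'.
  + intros s' t v Hs' Ht [a1 [b1 [P1 [S1 ->]]]].
    exists (- a1 / b1), (/ b1); split; [now apply Rinv_0_lt_compat|split].
    * now apply (shear_at_inverse m k x a1 b1 s').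
    * now rewrite ln_Rinv.
  + exists s, (ln b); split; [exact Hs|split; [now exists a, b|]].
    intros E; apply Nb; rewrite <- (exp_ln b Pb), E; apply exp_0.
- assert (H1 : forall s a b, In s l -> 0 < b -> shear_at m k x a b s -> b = 1).
  { intros s a b Hs Pb Hab; apply NNPP; intros Nb; apply N; now exists s, a, b. }
  (* All generators have [b = 1], so composition adds the coefficients [a]; that of [f0] is
     nonzero. *)
  apply (surjection_onto_Z l (fun f v => shear_at m k x v 1 f)).
  + apply shear_at_id.
  + intros f g v w S1 S2; assert (S := shear_at_comp m k x v 1 w 1 f g Rlt_0_1 S1 S2).
    now rewrite !Rmult_1_r, Rplus_comm in S.
  + intros f v w S1 S2; now destruct (shear_at_unique _ _ _ _ _ _ _ _ S1 S2).
  + intros s Hs; destruct (Hinv s Hs) as [t [a [b [Ht [Pb Hab]]]]].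
    exists t, a; split; [exact Ht|]; now rewrite <- (H1 s a b Hs Pb Hab).
  + intros s t v Hs Ht Hv; assert (S := shear_at_inverse m k x v 1 s t Rlt_0_1 Ht Hv).
    now rewrite Rdiv_1_r, Rinv_1 in S.
  + exists f0, a0; split; [exact Hf0|]; assert (E := H1 f0 a0 b0 Hf0 Pb0 H0); subst b0.
    split; [exact H0|tauto].
Qed.

Theorem mainTheorem18 : locally_indicable_PL /\ left_orderable_PL.
Proof.
  split; [exact PL_I2_locally_indicable|exact PL_I2_left_orderable].
Qed.
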